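(* Let $K$ be an infinite field of arbitrary characteristic, $R=K[x,y,z]$, and let $I=(x^a,y^b,z^c,x^{\alpha}y^{\beta}z^{\gamma})$ with integers $0<\alpha<a$, $0<\beta<b$, $0<\gamma<c$. Assume that $d:=\frac13(a+b+c+\alpha+\beta+\gamma)$ is an integer and that $\max\{a,b,c,\alpha+\beta+\gamma\}\le d$, $\min\{\alpha+\beta+c,\ \alpha+b+\gamma,\ a+\beta+\gamma\}\ge d$, and $\min\{a+b,a+c,b+c\}\ge d$. Then the following conditions are equivalent: (i) The algebra $R/I$ has the weak Lefschetz property. (ii) The determinant of $N(T_d(I))$ (i.e., the enumeration of signed lozenge tilings of $T_d(I)$) is not zero in $K$. (iii) The determinant of $Z(T_d(I))$ (i.e., the enumeration of signed perfect matchings of $G(T_d(I))$) is not zero in $K$. (iv) The generic splitting type of $\widetilde{\operatorname{syz} I}$ is $(-d,-d,-d)$.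
   Context: An Artinian standard graded $K$-algebra $A$ has the weak Lefschetz property if there is a linear form $\ell\in[A]_1$ such that for all integers $j$ the multiplication map $\times\ell:[A]_j\to[A]_{j+1}$ has maximal rank. $T_d(I)$: the equilateral triangle of side length $d$ is subdivided into unit triangles, the downward-pointing ones labelled by the monomials of degree $d-2$, the upward-pointing ones by the monomials of degree $d-1$ in $x,y,z$, such that triangles with labels $n$ (downward) and $m$ (upward) share an edge iff $m\in\{xn,yn,zn\}$; $T_d(I)$ consists of the unit triangles whose labels are not in $I$. Let $D$, $U$ be the sets of monomials not in $I$ of degree $d-2$, $d-1$, respectively. $G(T_d(I))$ is the bipartite graph on $D\cup U$ with edges between labels of adjacent triangles. Monomials of a fixed degree are ordered reverse-lexicographically ($x^ay^bz^c>x^py^qz^r$ if the last non-zero entry of $(a-p,b-q,c-r)$ is negative). $Z(T_d(I))$ is the bi-adjacency matrix of this graph: the $|D|\times|U|$ zero-one matrix with $(n,m)$ entry $1$ iff $m\in\{xn,yn,zn\}$. $N(T_d(I))$ is the lattice path matrix: let $A_1,\dots,A_m$ be the $u\in U$ with $z\nmid u$, and $E_1,\dots,E_n$ the monomials $u\in I$ of degree $d-1$ with $z\mid u$ and $u/z\notin I$, each listed from smallest to largest. The $(i,j)$ entry of $N(T_d(I))$ is the number of lattice paths in $\mathbb{Z}^2$ with steps $(1,0)$, $(0,-1)$ from $A_i$ to $E_j$, where $x^uy^vz^{d-1-u-v}$ is identified with $(d-1-v,u)$; for $A_i=x^sy^{d-1-s}$, $E_j=x^py^{d-1-p-e}z^e$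 it equals $\binom{e}{s-p}$. Under the assumptions both matrices are square. The syzygy module is defined by $0\to\operatorname{syz} I\to R(-\alpha-\beta-\gamma)\oplus R(-a)\oplus R(-b)\oplus R(-c)\to I\to0$, and $\widetilde{\operatorname{syz} I}$ is its sheafification on $\mathbb{P}^2$. Its generic splitting type is the triple $(p,q,r)$ such that its restriction to a general line $H$ is $\mathcal{O}_H(p)\oplus\mathcal{O}_H(q)\oplus\mathcal{O}_H(r)$. (Since $I$ is monomial, it may be computed on the line $x+y+z=0$.) *)

(* Defs.v *)
From HB Require Import structures.
From mathcomp Require Import all_boot all_order all_algebra.
From mathcomp.multinomials Require Export mpoly.

Set Implicit Arguments.
Unset Strict Implicit.
Unset Printing Implicit Defensive.

Import GRing.Theory.
Local Open Scope ring_scope.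

Definition infinite_field (K : fieldType) : Prop :=
  forall s : seq K, exists x : K, x \notin s.

(* [f] lies in [R]_t; there are no nonzero forms of negative degree. *)
Definition in_degree (K : fieldType) (n : nat) (t : int) (f : {mpoly K[n]}) :
    bool :=
  if t is Posz k then f \is k.-homog else f == 0.

Definition var_x : 'I_3 := @Ordinal 3 0 isT.
Definition var_y : 'I_3 := @Ordinal 3 1 isT.
Definition var_z : 'I_3 := @Ordinal 3 2 isT.

Definition mon3 (a b c : nat) : 'X_{1..3} := [multinom [tuple a; b; c]].

(* (x^a, y^b, z^c, x^al y^be z^ga) *)
Definition gens4 (a b c al be ga : nat) : 4.-tuple 'X_{1..3} :=
  [tuple mon3 a 0 0; mon3 0 b 0; mon3 0 0 c; mon3 al be ga].

Definition in_ideal (K : fieldType) (k : nat) (G : k.-tuple 'X_{1..3})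
    (f : {mpoly K[3]}) : Prop :=
  exists h : 'I_k -> {mpoly K[3]}, f = \sum_(i < k) h i * 'X_[tnth G i].

(* Ideal membership of a monomial; justified by [in_idealX]. *)
Definition mon_in_ideal (k : nat) (G : k.-tuple 'X_{1..3}) (m : 'X_{1..3}) :
    bool :=
  has (fun g => (g <= m)%MM) G.

Lemma in_idealX (K : fieldType) (k : nat) (G : k.-tuple 'X_{1..3})
    (m : 'X_{1..3}) :
  in_ideal G ('X_[m] : {mpoly K[3]}) <-> mon_in_ideal G m.
Proof.
split=> [[h hE]|/hasP [g /tnthP [i ->] le_gm]].
  apply/hasP; have : ('X_[m] : {mpoly K[3]})@_m != 0.
    by rewrite mcoeffX eqxx oner_eq0.
  rewrite hE raddf_sum /= => nz.
  have [i hi] : exists i : 'I_k, (h i * 'X_[tnth G i])@_m != 0.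
    apply/existsP; apply: contraNT nz => /existsPn nz.
    by apply/eqP; apply: big1 => i _; apply/eqP; move: (nz i); rewrite negbK.
  exists (tnth G i); first exact: mem_tnth.
  apply: contraNT hi => ngm; rewrite mcoeffM; apply/eqP; apply: big1.
  move=> [p q] /= /eqP mE; rewrite mcoeffX.
  case: eqP => [qE|]; last by rewrite mulr0.
  have : (tnth G i <= m)%MM by rewrite [X in (_ <= X)%MM]mE qE lem_addl.
  by rewrite (negbTE ngm).
exists (fun j => if j == i then 'X_[m - tnth G i] else 0).
rewrite (bigD1 i) //= eqxx -mpolyXD submK // big1 ?addr0 //.
by move=> j /negbTE ->; rewrite mul0r.
Qed.

(* Weak Lefschetz property of R/I for a homogeneous ideal I of R = K[x,y,z].
   Elements of [R/I]_j are given by representatives in [R]_j; "maximal rank"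
   means injective or surjective. *)
Definition weak_lefschetz (K : fieldType) (I : {mpoly K[3]} -> Prop) : Prop :=
  exists l : {mpoly K[3]}, l \is 1.-homog /\
    forall j : int,
      (forall f, in_degree j f -> I (l * f) -> I f) \/
      (forall g, in_degree (j + 1) g ->
         exists f, in_degree j f /\ I (g - l * f)).

(* n > m iff the last nonzero entry of the exponent difference n - m is
   negative. *)
Definition revlex_lt (m n : 'X_{1..3}) : bool :=
  [exists i : 'I_3, (n i < m i)%N && [forall j : 'I_3, (i < j)%N ==> (n j == m j)]].
Definition revlex_le (m n : 'X_{1..3}) : bool := (m == n) || revlex_lt m n.

Definition monomials (k : nat) : seq 'X_{1..3} :=
  sort revlex_le [seq m <- map val (enum {: 'X_{1..3 < k.+1}}) | mdeg m == k].

(* Downward and upward unit triangles of T_d(I), from smallest to largest. *)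
Definition down_triangles (d k : nat) (G : k.-tuple 'X_{1..3}) :
    seq 'X_{1..3} :=
  [seq m <- monomials (d - 2) | ~~ mon_in_ideal G m].
Definition up_triangles (d k : nat) (G : k.-tuple 'X_{1..3}) :
    seq 'X_{1..3} :=
  [seq m <- monomials (d - 1) | ~~ mon_in_ideal G m].

Definition Zmat (d k : nat) (G : k.-tuple 'X_{1..3}) :
    'M[int]_(size (down_triangles d G), size (up_triangles d G)) :=
  \matrix_(i, j)
    ([exists v : 'I_3, nth 0%MM (up_triangles d G) j ==
                       (U_(v) + nth 0%MM (down_triangles d G) i)%MM] : nat)%:Z.

(* A lattice path is coded by its sequence of steps, [true] standing for
   (1,0) and [false] for (0,-1). *)
Definition path_end (P : int * int) (s : seq bool) : int * int :=
  foldl (fun Q (e : bool) => if e then (Q.1 + 1, Q.2) else (Q.1, Q.2 - 1)) P s.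

Definition path_length (P Q : int * int) : nat :=
  (absz (Q.1 - P.1) + absz (P.2 - Q.2))%N.

Definition lattice_paths (P Q : int * int) : nat :=
  #|[set s : (path_length P Q).-tuple bool | path_end P s == Q]|.

(* The restriction on the length in [lattice_paths] loses no path. *)
Lemma size_lattice_path (P Q : int * int) (s : seq bool) :
  path_end P s = Q -> size s = path_length P Q.
Proof.
move=> <-; rewrite /path_length.
have H : forall P, path_end P s =
    (P.1 + (count id s)%:Z, P.2 - (count negb s)%:Z).
  elim: s => [|e s IH] [p q] /=; first by rewrite addr0 subr0.
  by rewrite -/(path_end _ s) IH; case: e => /=;
    rewrite ?add0n PoszD ?opprD addrA.
by rewrite H /= addrC addKr subKr !absz_nat -(count_predC id).
Qed.

(* x^u y^v z^(d-1-u-v) |-> (d-1-v, u) *)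
Definition mon_point (d : nat) (m : 'X_{1..3}) : int * int :=
  (d%:Z - 1 - (m var_y)%:Z, (m var_x)%:Z).

Definition lattice_starts (d k : nat) (G : k.-tuple 'X_{1..3}) :
    seq 'X_{1..3} :=
  [seq m <- up_triangles d G | ~~ (U_(var_z) <= m)%MM].
Definition lattice_ends (d k : nat) (G : k.-tuple 'X_{1..3}) :
    seq 'X_{1..3} :=
  [seq m <- monomials (d - 1) | [&& mon_in_ideal G m, (U_(var_z) <= m)%MM
                                  & ~~ mon_in_ideal G (m - U_(var_z))%MM]].

Definition Nmat (d k : nat) (G : k.-tuple 'X_{1..3}) :
    'M[int]_(size (lattice_starts d G), size (lattice_ends d G)) :=
  \matrix_(i, j)
    (lattice_paths (mon_point d (nth 0%MM (lattice_starts d G) i))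
                   (mon_point d (nth 0%MM (lattice_ends d G) j)))%:Z.

(* Graded R-modules are given by their homogeneous pieces inside an ambient
   R-module [V]: [M t v] says that [v] lies in the piece of degree [t]. *)

(* The direct sum of the R(p_i). *)
Definition twisted_free (K : fieldType) (n : nat) (p : 'I_n -> int) (t : int)
    (v : 'rV[{mpoly K[3]}]_n) : Prop :=
  forall i : 'I_n, in_degree (t + p i) (v 0 i).

Definition syz (K : fieldType) (k : nat) (G : k.-tuple 'X_{1..3}) (t : int)
    (v : 'rV[{mpoly K[3]}]_k) : Prop :=
  twisted_free (fun i => - (mdeg (tnth G i))%:Z) t v /\
  \sum_(i < k) v 0 i * 'X_[tnth G i] = 0.

(* Sections over D+(g), for a form g of degree e, of the sheaf associated with
   M/lM, that is, of the restriction of the sheafification of M to the line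
   H = {l = 0}: the fraction v/g^N with v of degree Ne is coded as (v, N). *)
Section Fractions.
Variables (K : fieldType) (V : lmodType {mpoly K[3]}) (M : int -> V -> Prop).
Variables (l : {mpoly K[3]}) (e : nat) (g : {mpoly K[3]}).

Definition frac_mem (x : V * nat) : Prop := M (x.2 * e)%N%:Z x.1.

(* Equality in the degree 0 part of the localization of M/lM at g. *)
Definition frac_eq (x y : V * nat) : Prop :=
  exists (k : nat) (w : V), M (((k + x.2 + y.2) * e)%N%:Z - 1) w /\
    g ^+ k *: (g ^+ y.2 *: x.1 - g ^+ x.2 *: y.1) = l *: w.

Definition frac_add (x y : V * nat) : V * nat :=
  (g ^+ y.2 *: x.1 + g ^+ x.2 *: y.1, (x.2 + y.2)%N).

Definition frac_scale (r : {mpoly K[3]} * nat) (x : V * nat) : V * nat :=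
  (r.1 *: x.1, (r.2 + x.2)%N).

End Fractions.

(* Restriction from D+(g) to D+(gh). *)
Definition frac_res (K : fieldType) (V : lmodType {mpoly K[3]})
    (h : {mpoly K[3]}) (x : V * nat) : V * nat :=
  (h ^+ x.2 *: x.1, x.2).

(* [phi e g] is the map on sections over D+(g), deg g = e. These open sets form
   a base of P^2, and isomorphisms of sheaves of modules on H are the same as
   isomorphisms of their direct images on P^2. *)
Record is_sheaf_iso (K : fieldType) (V V' : lmodType {mpoly K[3]})
    (M : int -> V -> Prop) (M' : int -> V' -> Prop) (l : {mpoly K[3]})
    (phi : nat -> {mpoly K[3]} -> V * nat -> V' * nat) : Prop := IsSheafIso {
  sheaf_iso_mem : forall e g, (0 < e)%N -> g \is e.-homog ->
    forall x, frac_mem M e x -> frac_mem M' e (phi e g x);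
  sheaf_iso_inj : forall e g, (0 < e)%N -> g \is e.-homog ->
    forall x y, frac_mem M e x -> frac_mem M e y ->
      frac_eq M l e g x y <-> frac_eq M' l e g (phi e g x) (phi e g y);
  sheaf_iso_surj : forall e g, (0 < e)%N -> g \is e.-homog ->
    forall y, frac_mem M' e y ->
      exists x, frac_mem M e x /\ frac_eq M' l e g (phi e g x) y;
  sheaf_iso_add : forall e g, (0 < e)%N -> g \is e.-homog ->
    forall x y, frac_mem M e x -> frac_mem M e y ->
      frac_eq M' l e g (phi e g (frac_add g x y))
                       (frac_add g (phi e g x) (phi e g y));
  sheaf_iso_scale : forall e g, (0 < e)%N -> g \is e.-homog ->
    forall (r : {mpoly K[3]}) (k : nat) x,
      r \is (k * e)%N.-homog -> frac_mem M e x ->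
      frac_eq M' l e g (phi e g (frac_scale (r, k) x))
                       (frac_scale (r, k) (phi e g x));
  sheaf_iso_res : forall e g e' h, (0 < e)%N -> g \is e.-homog ->
    (0 < e')%N -> h \is e'.-homog ->
    forall x, frac_mem M e x ->
      frac_eq M' l (e + e')%N (g * h) (phi (e + e')%N (g * h) (frac_res h x))
                                      (frac_res h (phi e g x))
}.

Definition restrictions_iso (K : fieldType) (V V' : lmodType {mpoly K[3]})
    (M : int -> V -> Prop) (M' : int -> V' -> Prop) (l : {mpoly K[3]}) : Prop :=
  exists phi, is_sheaf_iso M M' l phi.

(* [Q l] holds for all lines {l = 0} in a nonempty Zariski-open subset of the
   dual projective plane (the complement of the curve P = 0). *)
Definition for_general_line (K : fieldType) (Q : {mpoly K[3]} -> Prop) : Prop :=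
  exists (k : nat) (P : {mpoly K[3]}), [/\ P \is k.-homog, P != 0 &
    forall u : 'I_3 -> K, (exists i, u i != 0) -> P.@[u] != 0 ->
      Q (\sum_(i < 3) u i *: 'X_i)].

(* The restriction of the sheafification of M to a general line H is
   O_H(p) + O_H(q) + O_H(r). *)
Definition generic_splitting_type (K : fieldType)
    (V : lmodType {mpoly K[3]}) (M : int -> V -> Prop) (p q r : int) : Prop :=
  for_general_line (fun l : {mpoly K[3]} =>
    restrictions_iso M (@twisted_free K 3 (tnth [tuple p; q; r])) l).

(* Main.v *)
(* Put l = ux + vy + wz with w <> 0 and let q : R -> K[X] be dehomogenization on
   the line l = 0.  The tuples p of polynomials, deg p_i <= t - deg f_i, with
   sum_i p_i q(f_i) = 0 are the syzygies of degree t of the restricted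
   generators.  Everything is compared with the absence of such syzygies in
   degree d-1.
   - The socle of R/I lives in degrees >= d-2, so R/I has the weak Lefschetz
     property iff some l : [R/I]_{d-2} -> [R/I]_{d-1} is bijective.  The matrix
     of this map is Z with weights u, v, w; its determinant is det Z times a
     monomial in u, v, w.
   - ker Z and the left kernel of N are both the space of functionals on [R]_{d-1}
     that kill I and the multiples of x + y + z, so no sign count is needed.
   - Multiplication by l is injective in degree d-2 iff there is no syzygy of
     degree d-1 on the line, because I has no syzygies over R in degree < d.
   - If there is none, the three syzygies e - X p, where e runs over the
     constant vectors with sum_i e_i q(f_i)(0) = 0, form a basis of the
     restricted syzygy module, which gives O_H(-d)^3.
   - A nonzero syzygy of degree d-1 would be a nonzero section of O_H(-1)^3. *)
From HB Require Import structures.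
From Stdlib Require Import ClassicalEpsilon.
Require Import Defs.
From mathcomp Require Import all_boot all_order all_algebra.
From mathcomp Require Import perm zify ring.
Set Implicit Arguments.
Unset Strict Implicit.
Unset Printing Implicit Defensive.
Import Order.TTheory GRing.Theory Num.Theory.
Local Open Scope ring_scope.

(** * Degrees *)

Section Degree.
Variables (K : fieldType) (n : nat).
Implicit Types (f g : {mpoly K[n]}) (t : int) (m : 'X_{1..n}).

(** Monomials have nonnegative degree, so for negative [t] the criterion forces an empty support, in
    accordance with the convention of [in_degree]. *)
Lemma in_degreeP t f :
  reflect (forall m, m \in msupp f -> (mdeg m)%:Z = t) (in_degree t f).
Proof.
case: t => [k|k] /=.
  by apply: (iffP (dhomogP _ _ _)) => H m /H; [move=> -> | case].
apply: (iffP eqP) => [-> m|H]; first by rewrite msupp0.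
apply/msuppnil0; case: (msupp f) H => // m s H.
by have := H m (mem_head _ _).
Qed.

Lemma in_degree0 t : in_degree t (0 : {mpoly K[n]}).
Proof. by apply/in_degreeP => m; rewrite msupp0. Qed.

Lemma in_degreeD t f g : in_degree t f -> in_degree t g -> in_degree t (f + g).
Proof.
move=> /in_degreeP Hf /in_degreeP Hg; apply/in_degreeP => m /msuppD_le.
by rewrite mem_cat => /orP [/Hf|/Hg].
Qed.

Lemma in_degreeZ t c f : in_degree t f -> in_degree t (c *: f).
Proof.
by move=> /in_degreeP Hf; apply/in_degreeP => m /msuppZ_le /Hf.
Qed.

Lemma in_degreeN t f : in_degree t f -> in_degree t (- f).
Proof. by rewrite -scaleN1r; apply: in_degreeZ. Qed.

Lemma in_degreeB t f g : in_degree t f -> in_degree t g -> in_degree t (f - g).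
Proof. by move=> Hf Hg; apply/in_degreeD/in_degreeN. Qed.

Lemma in_degree_sum (I : eqType) (r : seq I) (P : pred I) t
    (F : I -> {mpoly K[n]}) :
  (forall i, i \in r -> P i -> in_degree t (F i)) ->
  in_degree t (\sum_(i <- r | P i) F i).
Proof.
move=> H; rewrite big_seq_cond; elim/big_ind: _ => [||i /andP []].
- exact: in_degree0.
- by move=> f g; apply: in_degreeD.
exact: H.
Qed.

Lemma in_degreeX m : in_degree (mdeg m)%:Z ('X_[m] : {mpoly K[n]}).
Proof. by rewrite /= dhomogX. Qed.

Lemma in_degreeM t s f g :
  in_degree t f -> in_degree s g -> in_degree (t + s) (f * g).
Proof.
move=> /in_degreeP Hf /in_degreeP Hg; apply/in_degreeP => m /msuppM_le.
by case/allpairsP => -[m1 m2] /= [/Hf <- /Hg <- ->]; rewrite mdegD.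
Qed.

Lemma in_degree_ind t (P : {mpoly K[n]} -> Prop) :
  P 0 -> (forall f g, P f -> P g -> P (f + g)) ->
  (forall c f, P f -> P (c *: f)) ->
  (forall m, (mdeg m)%:Z = t -> P 'X_[m]) ->
  forall f, in_degree t f -> P f.
Proof.
move=> P0 PD PZ PX f /in_degreeP Hf; rewrite (mpolyE f) big_seq.
by elim/big_ind: _ => // m /Hf /PX /PZ.
Qed.

(** A bound, not an exact degree: dehomogenizing a form of degree [t] can lower it. A negative [t]
    leaves only 0, so integer shifts are harmless. *)
Definition poly_degree t (p : {poly K}) : bool :=
  if t is Posz k then (size p <= k.+1)%N else p == 0.

Implicit Type p r : {poly K}.

Lemma poly_degreeP t p :
  reflect (forall i : nat, t < i%:Z -> p`_i = 0) (poly_degree t p).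
Proof.
case: t => k /=.
  apply: (iffP (leq_sizeP _ _)) => H i; first by rewrite ltz_nat; apply: H.
  by move=> Hi; apply: H; rewrite ltz_nat.
apply: (iffP eqP) => [-> i|H]; first by rewrite coef0.
by apply/polyP => i; rewrite coef0 H.
Qed.

Lemma poly_degree0 t : poly_degree t 0.
Proof. by apply/poly_degreeP => i; rewrite coef0. Qed.

Lemma poly_degreeD t p r :
  poly_degree t p -> poly_degree t r -> poly_degree t (p + r).
Proof.
move=> /poly_degreeP Hp /poly_degreeP Hr; apply/poly_degreeP => i Hi.
by rewrite coefD Hp ?Hr ?addr0.
Qed.

Lemma poly_degreeZ t c p : poly_degree t p -> poly_degree t (c *: p).
Proof.
move=> /poly_degreeP Hp; apply/poly_degreeP => i Hi.
by rewrite coefZ Hp ?mulr0.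
Qed.

Lemma poly_degreeB t p r :
  poly_degree t p -> poly_degree t r -> poly_degree t (p - r).
Proof.
by move=> Hp Hr; apply: poly_degreeD => //; rewrite -scaleN1r poly_degreeZ.
Qed.

Lemma poly_degree_sum (I : Type) (r : seq I) (P : pred I) t
    (F : I -> {poly K}) :
  (forall i, P i -> poly_degree t (F i)) ->
  poly_degree t (\sum_(i <- r | P i) F i).
Proof.
move=> H; elim/big_ind: _ => //; first exact: poly_degree0.
by move=> f g; apply: poly_degreeD.
Qed.

Lemma poly_degree_le t s p : t <= s -> poly_degree t p -> poly_degree s p.
Proof.
move=> Hts /poly_degreeP Hp; apply/poly_degreeP => i Hi; apply: Hp; lia.
Qed.

Lemma poly_degreeC c t : 0 <= t -> poly_degree t c%:P.
Proof.
by move=> Ht; apply/poly_degreeP => i Hi; rewrite coefC ifN //; apply/eqP; lia.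
Qed.

Lemma poly_degreeMX t p : poly_degree t ('X * p) = poly_degree (t - 1) p.
Proof.
apply/poly_degreeP/poly_degreeP => H i Hi.
  have := H i.+1; rewrite coefXM /= => -> //; lia.
by rewrite coefXM; case: eqP => // Hi0; apply: H; lia.
Qed.

Lemma poly_degreeM t s p r :
  poly_degree t p -> poly_degree s r -> poly_degree (t + s) (p * r).
Proof.
move=> /poly_degreeP Hp /poly_degreeP Hr; apply/poly_degreeP => i Hi.
rewrite coefM big1 // => j _; case: (ltrP t j) => Hj; first by rewrite Hp ?mul0r.
rewrite Hr ?mulr0 //; have := ltn_ord j; lia.
Qed.

End Degree.

(** * Monomial ideals and dehomogenization on a line *)

Section Ideal.
Variables (K : fieldType) (k : nat) (G : k.-tuple 'X_{1..3}).
Implicit Types (f g : {mpoly K[3]}) (m n : 'X_{1..3}).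

Lemma mon_in_idealD m n : mon_in_ideal G m -> mon_in_ideal G (m + n)%MM.
Proof.
case/hasP => g Gg le_gm; apply/hasP; exists g => //.
exact/(lepm_trans le_gm)/lem_addr.
Qed.

Lemma in_idealD f g : in_ideal G f -> in_ideal G g -> in_ideal G (f + g).
Proof.
move=> [h ->] [h' ->]; exists (fun i => h i + h' i).
by rewrite -big_split; apply: eq_bigr => i _; rewrite mulrDl.
Qed.

Lemma in_idealMl g f : in_ideal G f -> in_ideal G (g * f).
Proof.
move=> [h ->]; exists (fun i => g * h i).
by rewrite mulr_sumr; apply: eq_bigr => i _; rewrite mulrA.
Qed.

Lemma in_idealZ c f : in_ideal G f -> in_ideal G (c *: f).
Proof. by rewrite -mul_mpolyC; apply: in_idealMl. Qed.

Lemma in_ideal0 : in_ideal G (0 : {mpoly K[3]}).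
Proof. by exists (fun=> 0); rewrite big1 // => i _; rewrite mul0r. Qed.

Lemma in_ideal_msuppP f :
  in_ideal G f <-> {in msupp f, forall m, mon_in_ideal G m}.
Proof.
split=> [[h ->] m /msupp_sum_le /flatten_mapP [i _]|H].
  rewrite (perm_mem (msuppMX _ _)) => /mapP [n _ ->].
  by apply/hasP; exists (tnth G i); [apply: mem_tnth | apply: lem_addr].
rewrite (mpolyE f) big_seq; elim/big_ind: _; first exact: in_ideal0.
  exact: in_idealD.
by move=> m /H Im; apply/in_idealZ/in_idealX.
Qed.

(** Each term of [f] is assigned to one generator dividing it, so the cofactors can be taken
    homogeneous of the complementary degree. *)
Lemma in_ideal_homog t f : in_degree t f -> in_ideal G f ->
  exists h : 'I_k -> {mpoly K[3]},
    (forall i, in_degree (t - (mdeg (tnth G i))%:Z) (h i)) /\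
    f = \sum_(i < k) h i * 'X_[tnth G i].
Proof.
move=> /in_degreeP Hd /in_ideal_msuppP HI.
rewrite (mpolyE f) big_seq; elim/big_ind: _.
- exists (fun=> 0); split=> [i|]; first exact: in_degree0.
  by rewrite big1 // => i _; rewrite mul0r.
- move=> _ _ [h [Hh ->]] [h' [Hh' ->]]; exists (fun i => h i + h' i).
  split=> [i|]; first exact: in_degreeD.
  by rewrite -big_split; apply: eq_bigr => i _; rewrite mulrDl.
move=> m Hm; have /hasP [_ /tnthP [i ->] le_im] := HI _ Hm.
exists (fun j => if j == i then f@_m *: 'X_[m - tnth G i] else 0).
split=> [j|].
  case: eqP => [->|_]; last exact: in_degree0.
  rewrite -(Hd _ Hm) -[in X in X - _](submK le_im) mdegD PoszD addrK.
  exact/in_degreeZ/in_degreeX.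
rewrite (bigD1 i) //= eqxx -scalerAl -mpolyXD submK // big1 ?addr0 //.
by move=> j /negbTE ->; rewrite mul0r.
Qed.

End Ideal.

Definition linear_form (K : fieldType) (u : 'I_3 -> K) : {mpoly K[3]} :=
  \sum_(i < 3) u i *: 'X_i.

Lemma ord3P (P : 'I_3 -> Prop) :
  P var_x -> P var_y -> P var_z -> forall i, P i.
Proof.
by move=> Px Py Pz [[|[|[|//]]] Hi];
  [move: Px | move: Py | move: Pz]; congr P; apply: val_inj.
Qed.

Lemma big_ord3 (R : Type) (idx : R) (op : Monoid.law idx) (F : 'I_3 -> R) :
  \big[op/idx]_(i < 3) F i = op (F var_x) (op (F var_y) (F var_z)).
Proof.
rewrite !big_ord_recl big_ord0 Monoid.mulm1.
by congr (op (F _) (op (F _) (F _))); apply: val_inj.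
Qed.

Lemma mon3E (a b c : nat) :
  [/\ mon3 a b c var_x = a, mon3 a b c var_y = b & mon3 a b c var_z = c].
Proof. by []. Qed.

Lemma mon3_eta (m : 'X_{1..3}) : m = mon3 (m var_x) (m var_y) (m var_z).
Proof. by apply/mnmP; elim/ord3P. Qed.

Lemma mdeg3 (m : 'X_{1..3}) : mdeg m = (m var_x + (m var_y + m var_z))%N.
Proof. by rewrite mdegE big_ord3. Qed.

Lemma lem3E (m n : 'X_{1..3}) : (m <= n)%MM =
  [&& (m var_x <= n var_x)%N, (m var_y <= n var_y)%N & (m var_z <= n var_z)%N].
Proof.
apply/mnm_lepP/and3P => [H|[Hx Hy Hz]]; first by split; apply: H.
by elim/ord3P.
Qed.

Lemma mdeg_gt0_var n (m : 'X_{1..n}) : (0 < mdeg m)%N -> exists i, m i != 0%N.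
Proof.
move=> dm; apply/existsP; apply: contraLR dm => /existsPn H0.
by rewrite mdegE big1 // => i _; apply/eqP/negPn/H0.
Qed.

(* On the line u_x x + u_y y + u_z z = 0, u_z <> 0, with affine coordinate x/y. *)
Section Dehomogenization.
Variables (K : fieldType) (u : 'I_3 -> K).
Hypothesis uz : u var_z != 0.
Local Notation l := (linear_form u).

Definition dehom_var (i : 'I_3) : {poly K} :=
  tnth [tuple 'X; 1; - (u var_z)^-1 *: (u var_x *: 'X + (u var_y)%:P)] i.

Lemma dehom_varE :
  [/\ dehom_var var_x = 'X, dehom_var var_y = 1 &
      dehom_var var_z = - (u var_z)^-1 *: (u var_x *: 'X + (u var_y)%:P)].
Proof. by []. Qed.

Definition dehom : {mpoly K[3]} -> {poly K} := mmap (@polyC K) dehom_var.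

HB.instance Definition _ := GRing.RMorphism.copy dehom
  (mmap (@polyC K) dehom_var).

Lemma dehomZ c f : dehom (c *: f) = c *: dehom f.
Proof. by rewrite /dehom -mul_mpolyC rmorphM /= mmapC mul_polyC. Qed.

Lemma dehom_X i : dehom 'X_i = dehom_var i.
Proof. by rewrite /dehom mmapX mmap1U. Qed.

Lemma dehom_linear_form : dehom l = 0.
Proof.
rewrite /linear_form raddf_sum big_ord3 /= !dehomZ !dehom_X.
case: dehom_varE => -> -> ->; rewrite scalerA mulrN divff // scaleN1r.
by rewrite alg_polyC addrA subrr.
Qed.

(** Homogenization by powers of y. Forms in x and y alone represent R modulo [l], because [l]
    expresses z through x and y. *)
Definition hom (k : nat) (p : {poly K}) : {mpoly K[3]} :=
  \sum_(i < k.+1) p`_i *: 'X_[mon3 i (k - i) 0].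

Lemma homD k p r : hom k (p + r) = hom k p + hom k r.
Proof.
by rewrite /hom -big_split; apply: eq_bigr => i _; rewrite coefD scalerDl.
Qed.

Lemma homZ k c p : hom k (c *: p) = c *: hom k p.
Proof.
by rewrite /hom scaler_sumr; apply: eq_bigr => i _; rewrite coefZ scalerA.
Qed.

Lemma in_degree_hom k p : in_degree k%:Z (hom k p).
Proof.
apply: in_degree_sum => i _ _; apply: in_degreeZ.
suff Ek : mdeg (mon3 i (k - i) 0) = k by rewrite -[X in in_degree X%:Z _]Ek in_degreeX.
by rewrite mdeg3; case: (mon3E i (k - i) 0) => -> -> ->; have := ltn_ord i; lia.
Qed.

Lemma dehom_hom k (p : {poly K}) : (size p <= k.+1)%N -> dehom (hom k p) = p.
Proof.
move=> Hp; rewrite raddf_sum /= -[RHS](coefK p).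
rewrite poly_def (big_ord_widen _ (fun i => p`_i *: 'X^i) Hp) [RHS]big_mkcond.
apply: eq_bigr => i _; rewrite dehomZ /dehom mmapX /mmap1 big_ord3.
case: (mon3E i (k - i) 0) => -> -> ->; case: dehom_varE => -> -> _; rewrite expr1n expr0.
rewrite /=.
by rewrite !mulr1; case: ltnP => // /(nth_default 0) ->; rewrite scale0r.
Qed.

Lemma hom_mulX k p : hom k.+1 ('X * p) = 'X_var_x * hom k p.
Proof.
rewrite /hom big_ord_recl coefXM /= scale0r add0r mulr_sumr.
apply: eq_bigr => i _; rewrite coefXM /= -scalerAr -mpolyXD.
by congr (_ *: 'X_[_]); apply/mnmP; elim/ord3P; rewrite mnmDE mnm1E.
Qed.

Lemma hom_widen k (p : {poly K}) : (size p <= k.+1)%N -> hom k.+1 p = 'X_var_y * hom k p.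
Proof.
move=> Hp; rewrite /hom big_ord_recr /= [p`_k.+1]nth_default // scale0r addr0.
rewrite mulr_sumr; apply: eq_bigr => i _; rewrite -scalerAr -mpolyXD.
congr (_ *: 'X_[_]); apply/mnmP; elim/ord3P; rewrite mnmDE mnm1E //.
by change (k.+1 - i = 1 + (k - i))%N; have := ltn_ord i; lia.
Qed.

Lemma hom_mul_dehom_var k (p : {poly K}) (i : 'I_3) : (size p <= k.+1)%N ->
  (size (dehom_var i * p)%R <= k.+2)%N /\
  exists c : K, 'X_i * hom k p = hom k.+1 (dehom_var i * p) + c *: (l * hom k p).
Proof.
move=> Hp; have Hx : (size ('X * p)%R <= k.+2)%N.
  by apply: (leq_trans (size_polyMleq _ _)); rewrite size_polyX.
have Hy : (size p <= k.+2)%N by apply: leq_trans Hp _.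
case: dehom_varE => Dx Dy Dz; elim/ord3P: i; rewrite ?Dx ?Dy ?Dz.
- by split=> //; exists 0; rewrite scale0r addr0 hom_mulX.
- by rewrite mul1r; split=> //; exists 0; rewrite scale0r addr0 hom_widen.
rewrite -scalerAl mulrDl -scalerAl mul_polyC; split.
  apply: (leq_trans (size_scale_leq _ _)).
  rewrite (leq_trans (size_polyD _ _)) // geq_max.
  by rewrite !(leq_trans (size_scale_leq _ _)).
exists (u var_z)^-1; rewrite homZ homD !homZ hom_mulX hom_widen //.
rewrite /linear_form big_ord3 /= !mulrDl -!scalerAl !scalerDr !scalerA !mulNr.
by rewrite mulVf // scale1r !scaleNr addrACA addNr add0r addKr.
Qed.

(** Division by [l] with a remainder free of z, by induction on the degree of a monomial, splitting
    off one variable at a time. Hence the kernel of [dehom] on forms consists of the multiples of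
    [l]. *)
Lemma homK t f : in_degree t f ->
  poly_degree t (dehom f) /\
  exists h, in_degree (t - 1) h /\ f = hom (absz t) (dehom f) + l * h.
Proof.
elim/in_degree_ind.
- rewrite raddf0; split; first exact: poly_degree0.
  exists 0; split; first exact: in_degree0.
  by rewrite mulr0 addr0 -[X in hom _ X](scale0r 0) homZ scale0r.
- move=> f1 g [df [h [dh Ef]]] [dg [h' [dh' Eg]]]; rewrite raddfD /= homD.
  split; first exact: poly_degreeD.
  exists (h + h'); split; first exact: in_degreeD.
  by rewrite [in LHS]Ef [in LHS]Eg mulrDr addrACA.
- move=> c f1 [df [h [dh Ef]]]; rewrite dehomZ homZ; split.
    exact: poly_degreeZ.
  exists (c *: h); split; first exact: in_degreeZ.
  by rewrite [in LHS]Ef scalerDr scalerAr.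
case: t => // k m []; elim: k m => [|k IH] m Hm.
  move/eqP: Hm; rewrite mdeg_eq0 => /eqP ->; rewrite mpolyX0 rmorph1.
  split; first by rewrite /= size_poly1.
  exists 0; split; first exact: in_degree0.
  rewrite mulr0 addr0 /hom big_ord1 coef1 scale1r -mpolyX0.
  by congr 'X_[_]; apply/mnmP; elim/ord3P; rewrite mnm0E.
have [|i Hi] := @mdeg_gt0_var _ m; first by rewrite Hm.
move: Hm; rewrite -(@submK _ U_(i)%MM m) ?lep1mP // addmC mdegD mdeg1.
set m' := (m - _)%MM => -[/IH [/= d' [h [dh Eh]]]].
rewrite mpolyXD rmorphM /= dehom_X.
have [Hs [c Ec]] := hom_mul_dehom_var i d'; split=> //.
exists (c *: hom k (dehom 'X_[m']) + 'X_i * h); split.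
  rewrite subn1 -/(in_degree k%:Z _).
  apply: in_degreeD; first exact/in_degreeZ/in_degree_hom.
  suff -> : k%:Z = 1%N%:Z + (k%:Z - 1) by apply: in_degreeM => //; rewrite /= dhomogX /= mdeg1.
  by lia.
by rewrite [in LHS]Eh mulrDr Ec mulrDr -scalerAr addrA mulrCA.
Qed.

Lemma poly_degree_dehom t f : in_degree t f -> poly_degree t (dehom f).
Proof. by case/homK. Qed.

Lemma dehom_eq0 t f : in_degree t f -> dehom f = 0 ->
  exists h, in_degree (t - 1) h /\ f = l * h.
Proof.
case/homK=> _ [h [dh Ef]] f0; exists h; split=> //.
by rewrite [LHS]Ef f0 -[X in hom _ X](scale0r 0) homZ scale0r add0r.
Qed.

Lemma dehom_surj t (p : {poly K}) :
  poly_degree t p -> exists f, in_degree t f /\ dehom f = p.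
Proof.
case: t => [k|k] Hp; last first.
  by exists 0; rewrite raddf0 -(eqP Hp); split=> //; apply: in_degree0.
by exists (hom k p); rewrite dehom_hom //; split=> //; apply: in_degree_hom.
Qed.

End Dehomogenization.

(** * Multiplication by a linear form and the matrix Z *)

Lemma mem_monomials k m : (m \in monomials k) = (mdeg m == k).
Proof.
rewrite mem_sort mem_filter andbC; case: eqP => [Hm|_]; last by rewrite andbF.
rewrite andbT; apply/mapP.
have Hk : (mdeg m < k.+1)%N by rewrite Hm.
by exists (BMultinom Hk); rewrite ?mem_enum.
Qed.

Lemma uniq_monomials k : uniq (monomials k).
Proof.
by rewrite sort_uniq filter_uniq // map_inj_uniq ?enum_uniq //; apply: val_inj.
Qed.

Lemma homog_sum (K : fieldType) (k : nat) (f : {mpoly K[3]}) :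
  in_degree k%:Z f -> f = \sum_(m <- monomials k) f@_m *: 'X_[m].
Proof.
move=> /in_degreeP Hf; apply/mpolyP => m; rewrite raddf_sum /=.
have [Hm|Hm] := boolP (m \in monomials k).
  rewrite (bigD1_seq m) ?uniq_monomials //= mcoeffZ mcoeffX eqxx mulr1.
  by rewrite big1 ?addr0 // => n /negbTE nm; rewrite mcoeffZ mcoeffX nm mulr0.
rewrite big_seq big1 => [|n Hn].
  apply/eqP; rewrite mcoeff_eq0; apply: contra Hm => /Hf [<-].
  by rewrite mem_monomials.
rewrite mcoeffZ mcoeffX; case: eqP => [nm|_]; last by rewrite mulr0.
by rewrite -nm Hn in Hm.
Qed.

Section Bijectivity.
Variables (K : fieldType) (k : nat) (G : k.-tuple 'X_{1..3}) (d : nat).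
Hypothesis d2 : (2 <= d)%N.
Local Notation D := (down_triangles d G).
Local Notation U := (up_triangles d G).
Local Notation N := (size D).
Hypothesis eZ : size U = N.
Local Notation Dn i := (nth 0%MM D i).
Local Notation Un j := (nth 0%MM U j).
Implicit Types (f : {mpoly K[3]}) (m : 'X_{1..3}) (u : 'I_3 -> K).

Lemma mem_down m : (m \in D) = (mdeg m == (d - 2)%N) && ~~ mon_in_ideal G m.
Proof. by rewrite mem_filter mem_monomials andbC. Qed.

Lemma mem_up m : (m \in U) = (mdeg m == (d - 1)%N) && ~~ mon_in_ideal G m.
Proof. by rewrite mem_filter mem_monomials andbC. Qed.

Lemma uniq_down : uniq D. Proof. exact/filter_uniq/uniq_monomials. Qed.
Lemma uniq_up : uniq U. Proof. exact/filter_uniq/uniq_monomials. Qed.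

Lemma downP (i : 'I_N) : mdeg (Dn i) = (d - 2)%N /\ ~~ mon_in_ideal G (Dn i).
Proof.
by have := mem_nth 0%MM (ltn_ord i); rewrite mem_down => /andP [/eqP ? ?].
Qed.

Lemma upP (j : 'I_N) : mdeg (Un j) = (d - 1)%N /\ ~~ mon_in_ideal G (Un j).
Proof.
have : (j < size U)%N by rewrite eZ.
by move/(mem_nth 0%MM); rewrite mem_up => /andP [/eqP ? ?].
Qed.

Lemma down_index m : mdeg m = (d - 2)%N -> ~~ mon_in_ideal G m ->
  exists i : 'I_N, m = Dn i.
Proof.
move=> dm Im; have mD : m \in D by rewrite mem_down dm eqxx.
have Hi : (index m D < N)%N by rewrite index_mem.
by exists (Ordinal Hi); rewrite /= nth_index.
Qed.

Lemma up_index m : mdeg m = (d - 1)%N -> ~~ mon_in_ideal G m ->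
  exists j : 'I_N, m = Un j.
Proof.
move=> dm Im; have mU : m \in U by rewrite mem_up dm eqxx.
have Hi : (index m U < N)%N by rewrite -eZ index_mem.
by exists (Ordinal Hi); rewrite /= nth_index.
Qed.

(** The matrix, acting on rows, of multiplication by [linear_form u] from [R/I]_{d-2} to [R/I]_{d-1}
    in the monomial bases. At most one summand is nonzero, as two labels determine the variable. *)
Definition weight_mx (u : 'I_3 -> K) : 'M[K]_N :=
  \matrix_(i, j) \sum_v (if Un j == (U_(v) + Dn i)%MM then u v else 0).

Lemma weight_mxE u (i j : 'I_N) v :
  Un j = (U_(v) + Dn i)%MM -> weight_mx u i j = u v.
Proof.
move=> Uj; rewrite mxE (bigD1 v) //= Uj eqxx big1 ?addr0 // => w wv.
by rewrite eqm_add2r eq_mnm1 eq_sym (negbTE wv).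
Qed.

Lemma weight_mx0 u (i j : 'I_N) :
  ~~ [exists v, Un j == (U_(v) + Dn i)%MM] -> weight_mx u i j = 0.
Proof.
by move=> /existsPn H; rewrite mxE big1 // => v _; rewrite (negbTE (H v)).
Qed.

Lemma det_Zmat :
  (\det (castmx (erefl, eZ) (Zmat d G)))%:~R = \det (weight_mx (fun=> 1)).
Proof.
rewrite -det_map_mx; congr (\det _); apply/matrixP => i j.
rewrite mxE castmxE cast_ord_id mxE /=.
case: (boolP [exists v, _]) => [/existsP [v /eqP Hv]|H] /=.
  by rewrite (weight_mxE _ Hv).
by rewrite weight_mx0.
Qed.

(* In the Leibniz expansion every nonzero term of [weight_mx u] has the same
   weight: the product of the up labels over that of the down labels. *)
Lemma det_weight_mx u :
  \det (weight_mx u) =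
  (\prod_v u v ^+ (\sum_(j < N) Un j v - \sum_(i < N) Dn i v)%N) *
  \det (weight_mx (fun=> 1)).
Proof.
rewrite /determinant mulr_sumr; apply: eq_bigr => s _.
rewrite mulrCA; congr (_ * _).
(* The permutations with nonzero terms are perfect matchings. Along one, each entry is the value at
   [u] of [Un (s i)] divided by [Dn i], and only the sums of exponents survive in the product. *)
have [/forallP H|] := boolP [forall i, [exists v, Un (s i) == (U_(v) + Dn i)%MM]].
  have le_DU (i : 'I_N) v : (Dn i v <= Un (s i) v)%N.
    by have /existsP [w /eqP ->] := H i; rewrite mnmDE leq_addl.
  rewrite [X in _ * X]big1 ?mulr1 => [|i _]; last first.
    by have /existsP [v /eqP Hv] := H i; rewrite (weight_mxE _ Hv).
  rewrite (eq_bigr (fun i => \prod_v u v ^+ (Un (s i) v - Dn i v))) => [|i _].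
    rewrite exchange_big; apply: eq_bigr => v _ /=.
    rewrite prodrXr; congr (_ ^+ _).
    rewrite sumnB //; congr (_ - _)%N; symmetry.
    exact: (reindex_inj (@perm_inj _ s)).
  have /existsP [v /eqP Hv] := H i; rewrite (weight_mxE _ Hv) Hv.
  rewrite (bigD1 v) //= mnmDE mnm1E eqxx addnK expr1 big1 ?mulr1 // => w wv.
  by rewrite mnmDE mnm1E eq_sym (negbTE wv) subnn.
rewrite negb_forall => /existsP [i Hi].
rewrite [LHS](bigD1 i) // [X in _ = _ * X](bigD1 i) //=.
by rewrite !weight_mx0 // !mul0r mulr0.
Qed.

Lemma mcoeff_linear_formM u f m : in_degree (d - 2)%N%:Z f ->
  ~~ mon_in_ideal G m ->
  (linear_form u * f)@_m =
  \sum_(i < N) f@_(Dn i) * \sum_v (if m == (U_(v) + Dn i)%MM then u v else 0).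
Proof.
move=> /homog_sum Hf Im; rewrite [in LHS]Hf mulr_sumr raddf_sum /=.
transitivity (\sum_(n <- monomials (d - 2)) f@_n *
                \sum_v (if m == (U_(v) + n)%MM then u v else 0)).
  apply: eq_bigr => n _; rewrite -scalerAr mcoeffZ /linear_form mulr_suml.
  congr (_ * _); rewrite raddf_sum /=; apply: eq_bigr => v _.
  rewrite -scalerAl mcoeffZ -mpolyXD mcoeffX eq_sym.
  by case: eqP; rewrite ?mulr1 ?mulr0.
(* Monomials [n] in I contribute nothing: their multiples cannot equal [m], which is outside I. *)
rewrite (bigID (mon_in_ideal G)) /= big1 => [|n In].
  by rewrite add0r -big_filter (big_nth 0%MM) big_mkord.
rewrite big1 ?mulr0 // => v _; case: eqP => // mE.
by rewrite mE addmC mon_in_idealD in Im.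
Qed.

Lemma mcoeff_linear_formM_up u f (j : 'I_N) : in_degree (d - 2)%N%:Z f ->
  (linear_form u * f)@_(Un j) = ((\row_i f@_(Dn i)) *m weight_mx u) 0 j.
Proof.
move=> Hf; rewrite mcoeff_linear_formM //; last by case: (upP j).
by rewrite mxE; apply: eq_bigr => i _; rewrite !mxE.
Qed.

Definition down_poly (r : 'rV[K]_N) : {mpoly K[3]} :=
  \sum_(i < N) r 0 i *: 'X_[Dn i].

Lemma in_degree_down_poly r : in_degree (d - 2)%N%:Z (down_poly r).
Proof.
apply: in_degree_sum => i _ _; apply: in_degreeZ.
by case: (downP i) => <- _; apply: in_degreeX.
Qed.

Lemma down_polyK r : (\row_(i < N) (down_poly r)@_(Dn i)) = r.
Proof.
apply/rowP => i; rewrite mxE raddf_sum (bigD1 i) //= mcoeffZ mcoeffX eqxx mulr1.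
rewrite big1 ?addr0 // => j ji; rewrite mcoeffZ mcoeffX.
by rewrite nth_uniq ?uniq_down // (inj_eq val_inj) (negbTE ji) mulr0.
Qed.

Lemma in_degree_linear_form u : in_degree 1 (linear_form u).
Proof.
by apply: in_degree_sum => i _ _; apply: in_degreeZ; rewrite /= dhomogX /= mdeg1.
Qed.

Lemma in_degree_linear_formM u t f :
  in_degree t f -> in_degree (t + 1) (linear_form u * f).
Proof. by rewrite addrC; apply/in_degreeM/in_degree_linear_form. Qed.

Lemma succ_down : (d - 2)%N%:Z + 1 = (d - 1)%N%:Z.
Proof. by move: d2; clear; lia. Qed.

Definition inj_at (l : {mpoly K[3]}) (t : int) :=
  forall f, in_degree t f -> in_ideal G (l * f) -> in_ideal G f.

Definition surj_at (l : {mpoly K[3]}) (t : int) :=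
  forall g, in_degree (t + 1) g ->
    exists f, in_degree t f /\ in_ideal G (g - l * f).

Lemma in_ideal_up (g : {mpoly K[3]}) : in_degree (d - 1)%N%:Z g ->
  in_ideal G g <-> forall j : 'I_N, g@_(Un j) = 0.
Proof.
move=> /in_degreeP Hg; split=> [/in_ideal_msuppP H j|H].
  apply/eqP; rewrite mcoeff_eq0; case: (upP j) => _; apply: contra; exact: H.
apply/in_ideal_msuppP => m mg; apply: contraLR isT => Im.
have [j Hj] : exists j : 'I_N, m = Un j by apply: up_index => //; case: (Hg _ mg).
by move: mg; rewrite mcoeff_msupp Hj H eqxx.
Qed.

(** [weight_mx u] sends the coefficients of [f] outside I to those of l f outside I, so injectivity
    on R/I means a trivial left kernel. *)
Lemma det_inj u : reflect (inj_at (linear_form u) (d - 2)%N%:Z)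
                          (\det (weight_mx u) != 0).
Proof.
apply: (iffP idP) => [nz f df lf|inj].
  have r0 : (\row_(i < N) f@_(Dn i)) = 0.
    have Wu : weight_mx u \in unitmx by rewrite unitmxE unitfE.
    rewrite -[LHS](mulmxK Wu).
    suff -> : (\row_(i < N) f@_(Dn i)) *m weight_mx u = 0 by rewrite mul0mx.
    apply/rowP => j; rewrite -mcoeff_linear_formM_up // [RHS]mxE.
    have := in_degree_linear_formM u df; rewrite succ_down => dlf.
    by move: lf; rewrite in_ideal_up.
  apply/in_ideal_msuppP => m mf; apply: contraLR isT => Im.
  have [i Hi] : exists i : 'I_N, m = Dn i.
    by apply: down_index => //; move/in_degreeP: df => /(_ _ mf) [].
  by move/rowP/(_ i): r0; rewrite !mxE -Hi => /eqP; rewrite mcoeff_eq0 mf.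
apply/negP => /det0P [v /negP v0 vW]; apply: v0; apply/eqP.
have dv := in_degree_down_poly v.
have : in_ideal G (down_poly v).
  apply: inj => //; have := in_degree_linear_formM u dv; rewrite succ_down => dlf.
  by rewrite in_ideal_up // => j; rewrite mcoeff_linear_formM_up // down_polyK vW mxE.
move/in_ideal_msuppP => H; rewrite -[v]down_polyK; apply/rowP => i; rewrite !mxE.
by apply/eqP; rewrite mcoeff_eq0; case: (downP i) => _; apply: contra; apply: H.
Qed.

Lemma det_surj u : reflect (surj_at (linear_form u) (d - 2)%N%:Z)
                           (\det (weight_mx u) != 0).
Proof.
apply: (iffP idP) => [nz g|surj].
  have Wu : weight_mx u \in unitmx by rewrite unitmxE unitfE.
  rewrite succ_down => dg.
  pose f := down_poly ((\row_j g@_(Un j)) *m invmx (weight_mx u)).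
  have df : in_degree (d - 2)%N%:Z f by apply: in_degree_down_poly.
  exists f; split=> //; have := in_degree_linear_formM u df.
  rewrite succ_down => dlf; rewrite in_ideal_up; last exact: in_degreeB.
  move=> j; rewrite mcoeffB mcoeff_linear_formM_up // down_polyK.
  by rewrite mulmxKV // mxE subrr.
(* A right kernel vector [c] is orthogonal to the row space, and surjectivity puts every unit row
   into that space. *)
rewrite -det_tr; apply/negP => /det0P [c /negP c0 cW]; apply: c0; apply/eqP.
apply/rowP => j; rewrite mxE.
have dX : in_degree (d - 1)%N%:Z ('X_[Un j] : {mpoly K[3]}).
  by case: (upP j) => <- _; apply: in_degreeX.
have := surj 'X_[Un j]; rewrite succ_down => /(_ dX) [f [df]].
have := in_degree_linear_formM u df; rewrite succ_down => dlf.
rewrite in_ideal_up; last exact: in_degreeB.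
move=> H; have : (\row_i f@_(Dn i)) *m weight_mx u *m c^T = 0.
  by rewrite -mulmxA -[weight_mx u]trmxK -trmx_mul cW trmx0 mulmx0.
suff -> : (\row_i f@_(Dn i)) *m weight_mx u = delta_mx 0 j.
  by rewrite -rowE => /matrixP /(_ 0 0); rewrite !mxE.
apply/rowP => i; rewrite -mcoeff_linear_formM_up //.
have /eqP := H i; rewrite mcoeffB subr_eq0 => /eqP <-; rewrite mcoeffX !mxE /=.
by rewrite nth_uniq ?uniq_up ?eZ // (inj_eq val_inj) eq_sym.
Qed.

End Bijectivity.

(** * Kernels of Z and N *)

Lemma path_endE (P : int * int) (s : seq bool) :
  path_end P s = (P.1 + (count id s)%:Z, P.2 - (count negb s)%:Z).
Proof.
rewrite /path_end; elim: s P => [|e s IH] [p q] /=; first by rewrite addr0 subr0.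
by rewrite IH; case: e => /=; rewrite ?add0n PoszD ?opprD addrA.
Qed.

Definition paths_of_length (L : nat) (P Q : int * int) : nat :=
  #|[set s : L.-tuple bool | path_end P s == Q]|.

(** [path_length] takes absolute values. It differs from [L] only if some displacement has the wrong
    sign, and then there is no path of either length. *)
Lemma lattice_pathsE (L : nat) (P Q : int * int) :
  (Q.1 - P.1) + (P.2 - Q.2) = L%:Z -> lattice_paths P Q = paths_of_length L P Q.
Proof.
move=> HL; rewrite /lattice_paths.
have [<-//|ne] := eqVneq (path_length P Q) L.
transitivity 0%N.
  apply/eqP; rewrite cards_eq0; apply/eqP/setP => s; rewrite !inE.
  apply/negP => /eqP; rewrite path_endE => PQ; case/eqP: ne.
  have Hs : (count id s + count negb s)%N = path_length P Q.
    by rewrite -[RHS](size_tuple s) -(count_predC id s).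
  move: Hs HL (congr1 fst PQ) (congr1 snd PQ) => /=.
  move: (path_length P Q) (count id s) (count negb s) (P.1) (P.2) (Q.1) (Q.2).
  by move=> n k1 k2 p1 p2 q1 q2; lia.
apply/esym/eqP; rewrite cards_eq0; apply/eqP/setP => s; rewrite !inE.
apply/negP => /eqP /size_lattice_path; rewrite size_tuple => /esym HL'.
by rewrite HL' eqxx in ne.
Qed.

Lemma paths_of_length0 P Q : paths_of_length 0 P Q = (P == Q).
Proof.
rewrite /paths_of_length -sum1dep_card big_mkcond (big_pred1 [tuple]) /=.
  by rewrite (surjective_pairing P) /=; case: (_ == Q).
by move=> s; rewrite [s]tuple0; apply/esym/eqP.
Qed.

(** The end point depends only on the numbers of steps of both kinds, so removing the first step
    amounts to moving the end point back. *)
Lemma paths_of_lengthS L (P Q : int * int) :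
  paths_of_length L.+1 P Q =
  (paths_of_length L P (Q.1 - 1, Q.2)%R + paths_of_length L P (Q.1, Q.2 + 1)%R)%N.
Proof.
rewrite /paths_of_length -!sum1dep_card !(big_mkcond (fun _ => _ == _)) /=.
pose h (bs : bool * L.-tuple bool) := [tuple of bs.1 :: bs.2].
rewrite (reindex h) /=; last first.
  exists (fun s => (thead s, [tuple of behead s])) => [[b s]|s] _ /=.
    by rewrite theadE; congr (_, _); apply/val_inj.
  by rewrite [RHS]tuple_eta; apply/val_inj.
rewrite -(pair_bigA _ (fun b s => if path_end P (h (b, s)) == Q then 1%N else 0%N)).
rewrite big_bool /=; congr (_ + _)%N; apply: eq_bigr => s _;
  congr (if _ then _ else _); rewrite !path_endE /= !xpair_eqE [Q in LHS]surjective_pairing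
    xpair_eqE; lia.
Qed.

Section Kernels.
Variables (K : fieldType) (k : nat) (G : k.-tuple 'X_{1..3}) (d : nat).
Hypothesis d2 : (2 <= d)%N.
Implicit Types (m n : 'X_{1..3}) (W : 'X_{1..3} -> K).

(* The functionals on the forms of degree d-1 that vanish on multiples of
   x + y + z; such a functional is killed by I iff it lies in ker Z, and it is
   determined by its values at the monomials prime to z, which form a left
   kernel vector of N. *)
Definition balanced W n := W (U_(var_x) + n)%MM + W (U_(var_y) + n)%MM
  + W (U_(var_z) + n)%MM = 0.

Section Z.
Local Notation D := (down_triangles d G).
Local Notation U := (up_triangles d G).
Hypothesis eZ : size U = size D.
Local Notation Dn i := (nth 0%MM D i).
Local Notation Un j := (nth 0%MM U j).

(** A right kernel vector of Z, extended by 0 to the monomials in I, is such a [W]: row [n] of Z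
    states that [W] is balanced at [n]. The transpose is taken because [det0P] speaks of left
    kernels. *)
Lemma det_Z_kernel :
  \det (@weight_mx K k G d (fun=> 1)) != 0 <->
  forall W,
    (forall m, mdeg m = (d - 1)%N -> mon_in_ideal G m -> W m = 0) ->
    (forall n, mdeg n = (d - 2)%N -> ~~ mon_in_ideal G n -> balanced W n) ->
    forall m, mdeg m = (d - 1)%N -> W m = 0.
Proof.
have key (c : 'rV_(size D)) i : (c *m (@weight_mx K k G d (fun=> 1))^T) 0 i =
    \sum_v \sum_(j < size D) (if Un j == (U_(v) + Dn i)%MM then c 0 j else 0).
  rewrite mxE exchange_big; apply: eq_bigr => j _ /=.
  rewrite !mxE mulr_sumr; apply: eq_bigr => v _.
  by case: ifP => _; rewrite ?mulr1 ?mulr0.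
rewrite -det_tr; split=> [nz W WI Wb|H].
  have c0 : \row_(j < size D) W (Un j) = 0.
    apply: contraNeq nz => c0; apply/det0P; exists (\row_j W (Un j)) => //.
    apply/rowP => i; rewrite key [RHS]mxE; case: (downP i) => di Ii.
    rewrite -[RHS](Wb _ di Ii) big_ord3 /= -addrA.
    have E v : \sum_(j < size D) (if Un j == (U_(v) + Dn i)%MM
        then (\row_j0 W (Un j0)) 0 j else 0) = W (U_(v) + Dn i)%MM.
      have dv : mdeg (U_(v) + Dn i)%MM = (d - 1)%N by rewrite mdegD mdeg1 di; lia.
      have [Iv|Iv] := boolP (mon_in_ideal G (U_(v) + Dn i)%MM).
        rewrite WI // big1 // => j _; case: eqP => // Uj.
        by case: (upP eZ j) => _; rewrite Uj Iv.
      have [j Hj] := up_index eZ dv Iv; rewrite (bigD1 j) //= -Hj eqxx mxE -Hj.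
      rewrite big1 ?addr0 // => j' jj'; rewrite Hj.
      by rewrite nth_uniq ?uniq_up ?eZ // (inj_eq val_inj) (negbTE jj').
    by rewrite !E.
  move=> m dm; have [Im|Im] := boolP (mon_in_ideal G m); first exact: WI.
  have [j ->] := up_index eZ dm Im.
  by move/rowP/(_ j): c0; rewrite !mxE.
apply/negP => /det0P [c /negP c0 cZ]; apply: c0; apply/eqP/rowP => j.
pose W m := \sum_(j < size D) (if Un j == m then c 0 j else 0).
have WU (i : 'I_(size D)) : W (Un i) = c 0 i.
  rewrite /W (bigD1 i) //= eqxx big1 ?addr0 // => j' jj'.
  by rewrite nth_uniq ?uniq_up ?eZ // (inj_eq val_inj) (negbTE jj').
rewrite mxE -WU; apply: H; last by case: (upP eZ j).
  move=> m _ Im; apply: big1 => i _; case: eqP => // Ui.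
  by case: (upP eZ i) => _; rewrite Ui Im.
move=> n dn In; have [i ->] := down_index dn In.
by move/rowP/(_ i): cZ; rewrite key [RHS in _ = RHS -> _]mxE big_ord3 /= addrA.
Qed.

End Z.

Section N.
Local Notation A := (lattice_starts d G).
Local Notation E := (lattice_ends d G).
Hypothesis eN : size E = size A.
Local Notation An i := (nth 0%MM A i).
Local Notation En j := (nth 0%MM E j).

Lemma mem_starts m : (m \in A) =
  [&& mdeg m == (d - 1)%N, ~~ mon_in_ideal G m & m var_z == 0%N].
Proof. by rewrite mem_filter mem_up lep1mP negbK andbC -andbA. Qed.

Lemma mem_ends m : (m \in E) =
  [&& mdeg m == (d - 1)%N, mon_in_ideal G m, m var_z != 0%N
    & ~~ mon_in_ideal G (m - U_(var_z))%MM].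
Proof. by rewrite mem_filter mem_monomials lep1mP andbC. Qed.

Lemma uniq_starts : uniq A. Proof. exact/filter_uniq/uniq_up. Qed.
Lemma uniq_ends : uniq E. Proof. exact/filter_uniq/uniq_monomials. Qed.

Lemma startsP (i : 'I_(size A)) :
  [/\ mdeg (An i) = (d - 1)%N, ~~ mon_in_ideal G (An i) & An i var_z = 0%N].
Proof.
have := mem_nth 0%MM (ltn_ord i); rewrite mem_starts.
by case/and3P => /eqP ? ? /eqP.
Qed.

Definition paths_mx (f : nat -> 'X_{1..3}) : 'M[K]_(size A) :=
  \matrix_(i, j) (lattice_paths (mon_point d (An i)) (mon_point d (f j)))%:R.

Lemma det_Nmat : (\det (castmx (erefl, eN) (Nmat d G)))%:~R =
  \det (paths_mx (nth 0%MM E)).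
Proof.
rewrite -det_map_mx; congr (\det _); apply/matrixP => i j.
by rewrite mxE castmxE cast_ord_id !mxE /=.
Qed.

Definition paths_to (i : 'I_(size A)) m : nat :=
  lattice_paths (mon_point d (An i)) (mon_point d m).

(** Each step replaces a factor x or y by z, and the starts are free of z, so the exponent of z
    counts the steps. *)
Lemma paths_toE (i : 'I_(size A)) m : mdeg m = (d - 1)%N ->
  paths_to i m = paths_of_length (m var_z) (mon_point d (An i)) (mon_point d m).
Proof.
move=> dm; apply: lattice_pathsE; rewrite /mon_point /=.
by have [dA _ zA] := startsP i; move: dm dA; rewrite !mdeg3; lia.
Qed.

Lemma paths_to0 (i : 'I_(size A)) m : mdeg m = (d - 1)%N -> m var_z = 0%N ->
  paths_to i m = (An i == m).
Proof.
move=> dm zm; rewrite paths_toE // zm paths_of_length0; congr nat_of_bool.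
have [dA _ zA] := startsP i; rewrite /mon_point xpair_eqE.
apply/idP/eqP => [H|->]; last by rewrite !eqxx.
rewrite [LHS]mon3_eta [RHS]mon3_eta zA zm; move: dm dA; rewrite !mdeg3 => ? ?.
by congr (mon3 _ _ _); lia.
Qed.

Lemma paths_toS (i : 'I_(size A)) n : mdeg n = (d - 2)%N ->
  paths_to i (U_(var_z) + n)%MM =
  (paths_to i (U_(var_y) + n)%MM + paths_to i (U_(var_x) + n)%MM)%N.
Proof.
move=> dn; have dv v : mdeg (U_(v) + n)%MM = (d - 1)%N.
  by rewrite mdegD mdeg1 dn; lia.
rewrite !paths_toE // !mnmDE !mnm1E !add0n add1n paths_of_lengthS.
rewrite /mon_point !mnmDE !mnm1E /= !add0n.
by congr (paths_of_length _ _ (_, _) + paths_of_length _ _ (_, _))%N; lia.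
Qed.

(** Balance gives W(zn) = -W(xn) - W(yn). Lowering the exponent of z to 0 in this way sums the
    values at the starts over all lattice paths to [m], with one sign per step. *)
Lemma balanced_paths W :
  (forall n, mdeg n = (d - 2)%N -> balanced W n) ->
  (forall m, mdeg m = (d - 1)%N -> m var_z = 0%N -> mon_in_ideal G m -> W m = 0) ->
  forall m, mdeg m = (d - 1)%N ->
    W m = (-1) ^+ m var_z * \sum_(i < size A) W (An i) * (paths_to i m)%:R.
Proof.
move=> Wb WI m dm; have [e He] : exists e, m var_z = e by exists (m var_z).
rewrite He; elim: e m dm He => [|e IH] m dm He.
  rewrite expr0 mul1r; have [Im|Im] := boolP (mon_in_ideal G m).
    rewrite WI // big1 // => i _; rewrite paths_to0 //; case: eqP => [E|].
      by case: (startsP i) => _; rewrite E Im.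
    by rewrite mulr0.
  have mA : m \in A by rewrite mem_starts dm He Im !eqxx.
  have Hi : (index m A < size A)%N by rewrite index_mem.
  rewrite (bigD1 (Ordinal Hi)) //= paths_to0 //= nth_index // eqxx mulr1.
  rewrite big1 ?addr0 // => i Hii; rewrite paths_to0 //.
  case: eqP => [E|]; last by rewrite mulr0.
  by case/eqP: Hii; apply/val_inj; rewrite /= -E index_uniq ?uniq_starts.
have zm : (U_(var_z) <= m)%MM by rewrite lep1mP He.
move: dm He; rewrite -(submK zm) addmC; set n := (m - _)%MM => dm He.
have dn : mdeg n = (d - 2)%N by move: dm; rewrite mdegD mdeg1; lia.
have dv v : mdeg (U_(v) + n)%MM = (d - 1)%N by rewrite mdegD mdeg1 dn; lia.
have zn : n var_z = e by move: He; rewrite mnmDE mnm1E eqxx; lia.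
have /eqP := Wb n dn; rewrite addrC addr_eq0 => /eqP ->.
rewrite (IH (U_(var_x) + n)%MM) ?(IH (U_(var_y) + n)%MM) ?mnmDE ?mnm1E //.
rewrite -mulrDr exprS mulN1r mulNr; congr (- (_ * _)); rewrite -big_split.
by apply: eq_bigr => i _; rewrite paths_toS // natrD mulrDr addrC.
Qed.

(** A row vector prescribes values at the starts, and [balanced_paths] gives the only balanced
    extension vanishing on the z-free monomials of I. Column [j] of N tests, up to sign, whether it
    vanishes at [En j]. *)
Lemma det_N_kernel :
  \det (paths_mx (nth 0%MM E)) != 0 <->
  forall W,
    (forall n, mdeg n = (d - 2)%N -> balanced W n) ->
    (forall m, mdeg m = (d - 1)%N -> m var_z = 0%N -> mon_in_ideal G m -> W m = 0) ->
    (forall m, m \in E -> W m = 0) ->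
    forall m, mdeg m = (d - 1)%N -> W m = 0.
Proof.
have key (w : 'rV_(size A)) j : (w *m paths_mx (nth 0%MM E)) 0 j =
    \sum_(i < size A) w 0 i * (paths_to i (En j))%:R.
  by rewrite mxE; apply: eq_bigr => i _; rewrite mxE.
split=> [nz W Wb WI WE|H].
  have w0 : \row_(i < size A) W (An i) = 0.
    apply: contraNeq nz => w0; apply/det0P; exists (\row_i W (An i)) => //.
    apply/rowP => j; have Ej : En j \in E by rewrite mem_nth ?eN.
    rewrite key [RHS]mxE; have := WE _ Ej.
    have dj : mdeg (En j) = (d - 1)%N.
      by move: Ej; rewrite mem_ends => /and4P [/eqP].
    rewrite (balanced_paths Wb WI) // => /eqP; rewrite mulf_eq0 signr_eq0 /=.
    by move/eqP => {2}<-; apply: eq_bigr => i _; rewrite mxE.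
  move=> m dm; rewrite (balanced_paths Wb WI) // big1 ?mulr0 // => i _.
  by move/rowP/(_ i): w0; rewrite !mxE => ->; rewrite mul0r.
apply/negP => /det0P [w /negP w0 wN]; apply: w0; apply/eqP/rowP => i.
pose W m := (-1) ^+ m var_z * \sum_(i < size A) w 0 i * (paths_to i m)%:R.
have [dA _ zA] := startsP i.
have WA : W (An i) = w 0 i.
  rewrite /W zA expr0 mul1r (bigD1 i) //= paths_to0 // eqxx mulr1.
  rewrite big1 ?addr0 // => j ji; rewrite paths_to0 //.
  by rewrite nth_uniq ?uniq_starts // (inj_eq val_inj) (negbTE ji) mulr0.
rewrite mxE -WA; apply: H => //.
- move=> n dn; rewrite /balanced /W !mnmDE !mnm1E /= !add0n add1n exprS.
  rewrite -mulrDr mulN1r mulNr -mulrBr -big_split -sumrB big1 ?mulr0 // => j _.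
  by rewrite paths_toS //= natrD; ring.
- move=> m dm zm Im; rewrite /W big1 ?mulr0 // => j _; rewrite paths_to0 //.
  case: eqP => [E|]; last by rewrite mulr0.
  by case: (startsP j) => _; rewrite E Im.
move=> m mE; have Hj : (index m E < size A)%N by rewrite -eN index_mem.
move/rowP/(_ (Ordinal Hj)): wN; rewrite key /= nth_index // mxE /W => ->.
by rewrite mulr0.
Qed.

End N.

Hypothesis eN : size (lattice_ends d G) = size (lattice_starts d G).
Hypothesis eZ : size (up_triangles d G) = size (down_triangles d G).

(** Both kernels consist of the same [W]. If [W] kills I, balance at [n] in I is automatic.
    Conversely, induct on the exponent of z in zn in I: either n is outside I and zn is an end, or
    xn and yn lie in I with a smaller exponent and balance at n gives W(zn) = 0. *)
Lemma det_N_Z :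
  (\det (castmx (erefl, eN) (Nmat d G)))%:~R != 0 :> K <->
  (\det (castmx (erefl, eZ) (Zmat d G)))%:~R != 0 :> K.
Proof.
rewrite det_Nmat det_Zmat (det_N_kernel eN) (det_Z_kernel eZ); split=> H W.
  move=> WI Wb; apply: H => [n dn|m dm _|m].
  - have [In|In] := boolP (mon_in_ideal G n); last exact: Wb.
    have Wv v : W (U_(v) + n)%MM = 0.
      by apply: WI; [rewrite mdegD mdeg1 dn; lia | rewrite addmC mon_in_idealD].
    by rewrite /balanced !Wv !addr0.
  - exact: WI.
  by rewrite mem_ends => /and4P [/eqP ? ? _ _]; apply: WI.
move=> Wb WA WE; apply: H => [m|n dn _]; last exact: Wb.
have [e He] : exists e, m var_z = e by exists (m var_z).
elim: e m He => [|e IH] m He dm Im; first exact: WA.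
have zm : (U_(var_z) <= m)%MM by rewrite lep1mP He.
have [In|In] := boolP (mon_in_ideal G (m - U_(var_z))%MM); last first.
  by apply: WE; rewrite mem_ends dm Im He eqxx In.
move: dm He Im In; rewrite -{1 2 3 5}(submK zm) addmC; set n := (m - _)%MM.
move=> dm He _ In.
have dn : mdeg n = (d - 2)%N by move: dm; rewrite mdegD mdeg1; lia.
have zn : n var_z = e by move: He; rewrite mnmDE mnm1E eqxx; lia.
have Wv v : v != var_z -> W (U_(v) + n)%MM = 0.
  move=> vz; apply: IH; last by rewrite addmC mon_in_idealD.
    by rewrite mnmDE mnm1E (negbTE vz) zn.
  by rewrite mdegD mdeg1 dn; lia.
by have := Wb n dn; rewrite /balanced (Wv var_x) // (Wv var_y) // !add0r.
Qed.

End Kernels.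

(** * Lefschetz property and triangle counts *)

Section Lefschetz.
Variables (K : fieldType) (k : nat) (G : k.-tuple 'X_{1..3}) (d : nat).
Implicit Types (m n : 'X_{1..3}) (f : {mpoly K[3]}).

(* R/I has no socle in degrees below d-2. *)
Hypothesis socle : forall m, (mdeg m < d - 2)%N ->
  (forall v, mon_in_ideal G (U_(v) + m)%MM) -> mon_in_ideal G m.
Variable l : {mpoly K[3]}.

(** If l f is in I, so is l v f for each variable v. Injectivity one degree higher puts v f into I,
    and then every monomial of f is a socle monomial or lies in I. *)
Lemma inj_at_pred (t : nat) : (t < d - 2)%N ->
  inj_at G l t.+1%:Z -> inj_at G l t%:Z.
Proof.
move=> td inj f df lf; apply/in_ideal_msuppP => m mf; apply: socle.
  by move/in_degreeP: df => /(_ _ mf) [->].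
move=> v; have /in_ideal_msuppP : in_ideal G ('X_v * f).
  apply: inj; last by rewrite mulrCA; apply: in_idealMl.
  have -> : t.+1%:Z = 1%:Z + t%:Z by lia.
  by apply: in_degreeM => //; rewrite /= dhomogX /= mdeg1.
by apply; rewrite mcoeff_msupp mulrC mcoeffMX -mcoeff_msupp.
Qed.

(** The cokernel is generated in lower degree: a monomial is a variable times a monomial that is
    already hit modulo I. *)
Lemma surj_at_succ (t : nat) : surj_at G l t%:Z -> surj_at G l t.+1%:Z.
Proof.
move=> surj; apply: in_degree_ind.
- exists 0; split; first exact: in_degree0.
  by rewrite mulr0 subr0; apply: in_ideal0.
- move=> g1 g2 [f1 [df1 I1]] [f2 [df2 I2]]; exists (f1 + f2).
  split; first exact: in_degreeD.
  by rewrite mulrDr opprD addrACA; apply: in_idealD.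
- move=> c g [f [df I]]; exists (c *: f); split; first exact: in_degreeZ.
  by rewrite -scalerAr -scalerBr; apply: in_idealZ.
move=> m dm; have [|v Hv] := @mdeg_gt0_var _ m; first by lia.
move: dm; rewrite -(@submK _ U_(v)%MM m) ?lep1mP // addmC mdegD mdeg1.
move: (m - _)%MM => n dn.
have [|f [df I]] := surj 'X_[n].
  by rewrite (_ : t%:Z + 1 = (mdeg n)%:Z); [apply: in_degreeX | lia].
exists ('X_v * f); split.
  rewrite (_ : t.+1%:Z = 1%:Z + t%:Z); last by lia.
  by apply: in_degreeM => //; rewrite /= dhomogX /= mdeg1.
by rewrite mpolyXD mulrCA -mulrBr; apply: in_idealMl.
Qed.

Lemma weak_lefschetz_suff : l \is 1.-homog ->
  inj_at G l (d - 2)%N%:Z -> surj_at G l (d - 2)%N%:Z ->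
  weak_lefschetz (@in_ideal K k G).
Proof.
move=> l1 inj surj; exists l; split=> // -[t|t]; last first.
  by left=> f /= /eqP -> _; apply: in_ideal0.
have [td|dt] := leqP t (d - 2); [left|right].
  rewrite -(subKn td); elim: (d - 2 - t)%N => [|e IH]; first by rewrite subn0.
  have [ed|de] := ltnP e (d - 2).
    apply: inj_at_pred; first by lia.
    by rewrite (_ : (d - 2 - e.+1).+1 = d - 2 - e)%N //; lia.
  by rewrite (_ : d - 2 - e.+1 = d - 2 - e)%N //; lia.
rewrite -(subnKC (ltnW dt)); elim: (t - (d - 2))%N => [|e IH].
  by rewrite addn0.
by rewrite addnS; apply: surj_at_succ.
Qed.

End Lefschetz.

(** * The four-generated ideal: socle degrees, starts and ends *)

Section Gens.
Variables (a b c al be ga d : nat).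
Hypotheses (al0 : (0 < al)%N) (ala : (al < a)%N) (be0 : (0 < be)%N)
  (beb : (be < b)%N) (ga0 : (0 < ga)%N) (gac : (ga < c)%N).
Hypothesis hd : (3 * d = a + b + c + al + be + ga)%N.
Hypotheses (ad : (a <= d)%N) (bd : (b <= d)%N) (cd : (c <= d)%N)
  (abcd : (al + be + ga <= d)%N).
Hypotheses (dc : (d <= al + be + c)%N) (db : (d <= al + b + ga)%N)
  (da : (d <= a + be + ga)%N).
Hypotheses (dab : (d <= a + b)%N) (dac : (d <= a + c)%N) (dbc : (d <= b + c)%N).
Local Notation G := (gens4 a b c al be ga).

Lemma mon_in_gens4 m : mon_in_ideal G m =
  [|| (a <= m var_x)%N, (b <= m var_y)%N, (c <= m var_z)%N |
      [&& (al <= m var_x)%N, (be <= m var_y)%N & (ga <= m var_z)%N]].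
Proof.
rewrite /mon_in_ideal /= !lem3E.
case: (mon3E a 0 0) => -> -> ->; case: (mon3E 0 b 0) => -> -> ->.
case: (mon3E 0 0 c) => -> -> ->; case: (mon3E al be ga) => -> -> ->.
by rewrite !leq0n !andbT /= orbF.
Qed.

(** A socle monomial outside I has exponents (al-1, b-1, c-1), (a-1, be-1, c-1) or (a-1, b-1, ga-1).
    In the first case its degree is at least d-2 because b + c >= d and al > 0; the others are
    analogous. *)
Lemma gens4_socle m : (mdeg m < d - 2)%N ->
  (forall v, mon_in_ideal G (U_(v) + m)%MM) -> mon_in_ideal G m.
Proof.
move=> dm H; move: dm (H var_x) (H var_y) (H var_z).
rewrite !mon_in_gens4 !mnmDE !mnm1E mdeg3 /= !add0n !add1n; lia.
Qed.

(** As ga > 0, only x^a and y^b restrict monomials free of z; the exponent [s] of x satisfies d-b <=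
    s < a. *)
Lemma size_starts : size (lattice_starts d G) = (a + b - d)%N.
Proof.
rewrite -(size_iota (d - b) (a + b - d)) -(size_map (fun s => mon3 s (d - 1 - s) 0)).
apply/perm_size/uniq_perm; first exact: uniq_starts.
  rewrite map_inj_in_uniq ?iota_uniq // => s t _ _ /mnmP /(_ var_x).
  by case: (mon3E s (d - 1 - s) 0) => -> _ _; case: (mon3E t (d - 1 - t) 0) => ->.
move=> m; rewrite mem_starts mon_in_gens4 mdeg3; apply/idP/mapP => [H|[s Hs ->]].
  exists (m var_x); first by rewrite mem_iota; lia.
  by rewrite [LHS]mon3_eta; congr mon3; lia.
by move: Hs; rewrite mem_iota; case: (mon3E s (d - 1 - s) 0) => -> -> ->; lia.
Qed.

(** Ends enter I on multiplication by z, so their exponent of z is c or ga. In the first case the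
    exponent of x runs over [0, d-c), in the second over [al, d-be-ga). The lower bounds on sums
    such as a + c and al + be + c exclude interference of the other generators. *)
Lemma size_ends : size (lattice_ends d G) = (a + b - d)%N.
Proof.
have -> : (a + b - d = (d - al - be - ga) + (d - c))%N by lia.
rewrite -(size_iota al (d - al - be - ga)) -[in RHS](size_iota 0 (d - c)).
rewrite -(size_map (fun s => mon3 s (d - 1 - ga - s) ga)).
rewrite -[X in (_ + X)%N](size_map (fun s => mon3 s (d - 1 - c - s) c)) -size_cat.
apply/perm_size/uniq_perm; first exact: uniq_ends.
  rewrite cat_uniq !map_inj_in_uniq ?iota_uniq /=; first last.
  - move=> s t _ _ /mnmP /(_ var_x).
    by case: (mon3E s (d - 1 - ga - s) ga) => -> _ _;
      case: (mon3E t (d - 1 - ga - t) ga) => ->.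
  - move=> s t _ _ /mnmP /(_ var_x).
    by case: (mon3E s (d - 1 - c - s) c) => -> _ _;
      case: (mon3E t (d - 1 - c - t) c) => ->.
  rewrite andbT; apply/hasPn => _ /mapP [s _ ->]; apply/mapP => -[t _].
  move/mnmP/(_ var_z); case: (mon3E s (d - 1 - c - s) c) => _ _ ->.
  by case: (mon3E t (d - 1 - ga - t) ga) => _ _ ->; lia.
move=> m; rewrite mem_ends !mon_in_gens4 mdeg3 !mnmBE !mnm1E /= !subn0 mem_cat.
apply/idP/orP => [H|[] /mapP [s Hs ->]].
- have [mc|mc] := eqVneq (m var_z) c; [right|left]; apply/mapP; exists (m var_x).
  + by rewrite mem_iota; lia.
  + by rewrite [LHS]mon3_eta; congr mon3; lia.
  + by rewrite mem_iota; lia.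
  by rewrite [LHS]mon3_eta; congr mon3; lia.
- move: Hs; rewrite mem_iota.
  by case: (mon3E s (d - 1 - ga - s) ga) => -> -> ->; lia.
move: Hs; rewrite mem_iota.
by case: (mon3E s (d - 1 - c - s) c) => -> -> ->; lia.
Qed.

End Gens.

(** Among the zn with n outside I, those outside I are the up triangles divisible by z, and those in
    I are the ends. Thus D corresponds to U with the starts exchanged for the ends. *)
Lemma size_up_down (k : nat) (G : k.-tuple 'X_{1..3}) (d : nat) : (2 <= d)%N ->
  size (lattice_ends d G) = size (lattice_starts d G) ->
  size (up_triangles d G) = size (down_triangles d G).
Proof.
move=> d2 eN; rewrite -(count_predC (fun m => U_(var_z) <= m)%MM).
rewrite [X in (_ + X)%N]/= -!size_filter -/(lattice_starts d G) -eN -size_cat.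
rewrite -(size_map (fun m => U_(var_z) + m)%MM (down_triangles d G)).
apply/perm_size/uniq_perm.
- rewrite cat_uniq filter_uniq ?uniq_up // uniq_ends andbT /=.
  apply/hasPn => m; rewrite mem_ends mem_filter mem_up.
  by case/and4P => _ -> _ _; rewrite !andbF.
- by rewrite map_inj_uniq ?uniq_down // => m n; apply: addmI.
move=> m; rewrite mem_cat mem_filter mem_up mem_ends lep1mP.
apply/idP/mapP => [H|[n]].
  have zm : m var_z != 0%N by case/orP: H => [/andP []|/and4P []].
  exists (m - U_(var_z))%MM; last by rewrite addmC submK // lep1mP.
  have dm : mdeg m == (d - 1)%N by case/orP: H => [/and3P []|/and4P []].
  rewrite mem_down; apply/andP; split.
    by move: dm; rewrite -{1}(@submK _ U_(var_z)%MM m) ?lep1mP // mdegD mdeg1; lia.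
  case/orP: H => [/and3P [_ _]|/and4P [_ _ _ //]].
  apply: contra => In; rewrite -(@submK _ U_(var_z)%MM m) ?lep1mP //.
  exact: mon_in_idealD.
rewrite mem_down => /andP [/eqP dn In] ->.
rewrite mnmDE mnm1E eqxx mdegD mdeg1 dn [(U_(var_z) + n)%MM]addmC addmK In.
have -> : (1 + (d - 2) == d - 1)%N by lia.
by case: (mon_in_ideal _ _).
Qed.

(** * Syzygies over K[X] *)

Section PolySyzygies.
Variables (K : fieldType) (n : nat) (A : 'I_n.+1 -> nat) (F : 'I_n.+1 -> {poly K}).
Implicit Types (t : int) (p : 'rV[{poly K}]_n.+1).

Definition poly_tuple t p := forall i, poly_degree (t - (A i)%:Z) (p 0 i).

Definition poly_syz t p := poly_tuple t p /\ \sum_i p 0 i * F i = 0.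

Lemma dvdp_X_coef0 (p : {poly K}) : p`_0 = 0 -> p = 'X * drop_poly 1 p.
Proof.
by move=> p0; apply/polyP => -[|i]; rewrite coefXM //= coef_drop_poly addn1.
Qed.

Lemma dvd_X_row m (p : 'rV[{poly K}]_m) :
  (forall i, (p 0 i)`_0 = 0) -> exists q, p = 'X *: q.
Proof.
move=> H; exists (\row_i drop_poly 1 (p 0 i)); apply/rowP => i.
by rewrite !mxE -dvdp_X_coef0.
Qed.

Lemma poly_tupleB t p q : poly_tuple t p -> poly_tuple t q -> poly_tuple t (p - q).
Proof. by move=> Hp Hq i; rewrite !mxE poly_degreeB. Qed.

Lemma poly_tuple_le s t p : s <= t -> poly_tuple s p -> poly_tuple t p.
Proof. by move=> st Hp i; apply: poly_degree_le (Hp i); lia. Qed.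

Lemma poly_tupleMX t p : poly_tuple t ('X *: p) <-> poly_tuple (t - 1) p.
Proof.
by split=> H i; have := H i; rewrite mxE poly_degreeMX addrAC.
Qed.

Lemma poly_syzMX t p : poly_syz t ('X *: p) -> poly_syz (t - 1) p.
Proof.
case=> /poly_tupleMX Hp Hs; split=> //; apply/eqP.
rewrite -(orFb (_ == 0)) -(polyX_eq0 K) -mulf_eq0 mulr_sumr -[X in _ == X]Hs.
by apply/eqP/eq_bigr => i _; rewrite mxE mulrA.
Qed.

Variables (d : nat) (j0 : 'I_n.+1).
Hypothesis F_deg : forall i, poly_degree (A i)%:Z (F i).
Hypothesis F_j0 : (F j0)`_0 = 1.
Hypothesis A_le : forall i, (A i <= d)%N.
Hypothesis syz_eq0 : forall p, poly_syz (d%:Z - 1) p -> p = 0.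
Hypothesis span : forall g, poly_degree (d%:Z - 1) g ->
  exists p, poly_tuple (d%:Z - 1) p /\ g = \sum_i p 0 i * F i.

Lemma poly_tupleC (e : 'rV[K]_n.+1) : poly_tuple d%:Z (map_mx polyC e).
Proof. by move=> i; rewrite mxE poly_degreeC //; have := A_le i; lia. Qed.

(** Coordinate [j0], where [F] has value 1 at 0, cancels the constant term of [F (lift j0 k)]. What
    remains is X g with g of degree at most d-1; [span] then yields the correction X p, which does
    not affect constant terms. *)
Lemma basis_syz (k : 'I_n) : exists s, poly_syz d%:Z s /\
  forall k', (s 0 (lift j0 k'))`_0 = (k' == k)%:R.
Proof.
pose e : 'rV_n.+1 := delta_mx 0 (lift j0 k) - (F (lift j0 k))`_0 *: delta_mx 0 j0.
have eF : \sum_i map_mx polyC e 0 i * F i =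
    F (lift j0 k) - (F (lift j0 k))`_0 *: F j0.
  have delta j : \sum_i (delta_mx 0 j : 'rV_n.+1) 0 i *: F i = F j.
    rewrite (bigD1 j) //= mxE !eqxx scale1r big1 ?addr0 // => i /negbTE ij.
    by rewrite mxE ij andbF scale0r.
  rewrite -[X in _ = X - _]delta -[X in _ = _ - _ *: X]delta scaler_sumr -sumrB.
  apply: eq_bigr => i _; rewrite !mxE mul_polyC scalerBl scalerA //.
have deF : poly_degree d%:Z (\sum_i map_mx polyC e 0 i * F i).
  rewrite eF; apply: poly_degreeB; last apply: poly_degreeZ;
    by apply: poly_degree_le (F_deg _); have := A_le (lift j0 k); have := A_le j0; lia.
have := @dvdp_X_coef0 (\sum_i map_mx polyC e 0 i * F i).
rewrite {1}eF coefB coefZ F_j0 mulr1 subrr => /(_ erefl).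
move: (drop_poly _ _) => g Hg; move: deF; rewrite Hg poly_degreeMX.
case/span=> p [dp gE]; exists (map_mx polyC e - 'X *: p); split.
  split; first by apply: poly_tupleB; [apply: poly_tupleC | apply/poly_tupleMX].
  rewrite (eq_bigr (fun i => map_mx polyC e 0 i * F i - 'X * (p 0 i * F i))).
    by rewrite sumrB Hg gE mulr_sumr subrr.
  by move=> i _; rewrite [in LHS]mxE [in X in _ + X]mxE [('X *: p) 0 i]mxE mulrBl mulrA.
move=> k'; rewrite !mxE coefB coefXM subr0 coefC /=.
by rewrite (inj_eq lift_inj) [_ == j0]eq_sym (negbTE (neq_lift j0 k')) mulr0 subr0.
Qed.

(** Off [j0] the constant terms of the rows of [s] form the identity matrix, so those of the
    coefficients can be read off. Independence and generation then follow by repeatedly dividing by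
    X. *)
Lemma poly_syz_basis : exists s : 'M[{poly K}]_(n, n.+1),
  [/\ forall k, poly_syz d%:Z (row k s),
      forall w : 'rV_n, w *m s = 0 -> w = 0 &
      forall t p, poly_syz t p -> exists w : 'rV_n,
        (forall k, poly_degree (t - d%:Z) (w 0 k)) /\ p = w *m s].
Proof.
have [f Hf] := fin_all_exists basis_syz.
pose s : 'M_(n, n.+1) := \matrix_k f k.
have rs k : row k s = f k by apply: rowK.
have s0 (w : 'rV_n) k : ((w *m s) 0 (lift j0 k))`_0 = (w 0 k)`_0.
  rewrite mxE coef_sum (bigD1 k) //= coef0M mxE (proj2 (Hf k)) eqxx mulr1.
  rewrite big1 ?addr0 // => k' kk'; rewrite coef0M mxE (proj2 (Hf k')).
  by rewrite eq_sym (negbTE kk') mulr0.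
exists s; split=> [k|w|t p].
- by rewrite rs; case: (Hf k).
- have [N] : exists N, forall k, (size (w ord0 k) <= N)%N.
    by exists (\max_k size (w ord0 k))%N => k; apply: (leq_bigmax k).
  elim: N w => [|N IH] w HN ws.
    by apply/rowP => k; rewrite mxE; apply/eqP; rewrite -size_poly_leq0.
  have [k|w' Ew] := @dvd_X_row _ w; first by rewrite -s0 ws mxE coef0.
  rewrite Ew (IH w') ?scaler0 // => [k|]; last first.
    move: ws; rewrite Ew -scalemxAl => /eqP; rewrite scalemx_eq0 polyX_eq0 /=.
    by move/eqP.
  have := HN k; rewrite Ew mxE; have [->|w0] := eqVneq (w' 0 k) 0.
    by rewrite size_poly0.
  by rewrite mulrC size_mulX.
move=> Hp; have [td|dt] := ltrP t d%:Z.
  exists 0; split=> [k|]; first by rewrite mxE poly_degree0.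
  rewrite mul0mx; apply: syz_eq0; case: Hp => Hp Hs; split=> //.
  by apply: poly_tuple_le Hp; lia.
(* Degrees are counted from d-1, where [syz_eq0] starts the induction. *)
have [m tE] : exists m : nat, t = d%:Z - 1 + m%:Z.
  by exists (absz (t - d%:Z + 1)); lia.
rewrite {dt}tE in Hp *; elim: m p Hp => [|m IH] p Hp.
  exists 0; split=> [k|]; first by rewrite mxE poly_degree0.
  by rewrite mul0mx; apply: syz_eq0; move: Hp; rewrite addr0.
pose w0 : 'rV[K]_n := \row_k (p 0 (lift j0 k))`_0.
have Hw : poly_syz (d%:Z - 1 + m.+1%:Z) (map_mx polyC w0 *m s).
  split=> [i|].
    rewrite mxE; apply: poly_degree_sum => k _; rewrite mxE mul_polyC.
    apply/poly_degreeZ; have [[+ _] _] := Hf k.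
    by move/(_ i); rewrite -rs mxE; apply: poly_degree_le; lia.
  under eq_bigr => i _ do rewrite mxE mulr_suml.
  rewrite exchange_big big1 // => k _ /=.
  under eq_bigr => i _ do rewrite -mulrA.
  rewrite -mulr_sumr (_ : \sum_i _ = 0) ?mulr0 //.
  by have [[_ E] _] := Hf k; rewrite -[RHS]E; apply: eq_bigr => i _; rewrite mxE.
have H : poly_syz (d%:Z - 1 + m.+1%:Z) (p - map_mx polyC w0 *m s).
  case: Hp Hw => Hp Ep [Hw Ew]; split; first exact: poly_tupleB.
  under eq_bigr => i _ do rewrite !mxE mulrBl.
  rewrite sumrB Ep sub0r; apply/eqP; rewrite oppr_eq0; apply/eqP.
  by rewrite -[RHS]Ew; apply: eq_bigr => i _; rewrite mxE.
have lift0 k : ((p - map_mx polyC w0 *m s) 0 (lift j0 k))`_0 = 0.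
  rewrite (_ : (p - _) 0 _ = p 0 (lift j0 k) - (map_mx polyC w0 *m s) 0 (lift j0 k)).
    by rewrite coefB s0 !mxE coefC subrr.
  by rewrite mxE; congr (_ + _); rewrite mxE.
(* Off [j0] the constant terms vanish by the choice of [w0]; at [j0] the relation evaluated at 0
   forces it. *)
have [i|q Eq] := @dvd_X_row _ (p - map_mx polyC w0 *m s).
  case: (unliftP j0 i) => [k|] -> //.
  have := congr1 (fun r : {poly K} => r`_0) (proj2 H).
  rewrite coef0 coef_sum (bigD1 j0) //= coef0M F_j0 mulr1 big1 ?addr0 // => j.
  by case: (unliftP j0 j) => [k|] -> ; rewrite ?eqxx // coef0M lift0 mul0r.
move: H; rewrite Eq => /poly_syzMX; rewrite (_ : _ - 1 = d%:Z - 1 + m%:Z); last by lia.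
case/IH=> w [dw qE]; exists (map_mx polyC w0 + 'X *: w); split=> [k|].
  rewrite !mxE; apply: poly_degreeD; first by apply: poly_degreeC; lia.
  by rewrite poly_degreeMX; apply: poly_degree_le (dw k); lia.
by rewrite mulmxDl -scalemxAl -qE -Eq addrC subrK.
Qed.

End PolySyzygies.

(** * Restriction of the syzygy sheaf to a line *)

(* With f = 0 this is the free module, with f the generators of I it is syz I. *)
Definition relations (K : fieldType) (n : nat) (p : 'I_n -> int)
    (f : 'I_n -> {mpoly K[3]}) (t : int) (v : 'rV[{mpoly K[3]}]_n) : Prop :=
  twisted_free p t v /\ \sum_(i < n) v 0 i * f i = 0.

Section Relations.
Variables (K : fieldType) (n : nat) (p : 'I_n -> int) (f : 'I_n -> {mpoly K[3]}).
Local Notation M := (relations p f).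

Lemma relationsD t v w : M t v -> M t w -> M t (v + w).
Proof.
move=> [Hv Ev] [Hw Ew]; split=> [i|]; first by rewrite mxE; apply: in_degreeD.
under eq_bigr => i _ do rewrite mxE mulrDl.
by rewrite big_split /= Ev Ew addr0.
Qed.

Lemma relationsZ s t r v : in_degree s r -> M t v -> M (s + t) (r *: v).
Proof.
move=> Hr [Hv Ev]; split=> [i|]; first by rewrite mxE -addrA; apply: in_degreeM.
under eq_bigr => i _ do rewrite mxE -mulrA.
by rewrite -mulr_sumr Ev mulr0.
Qed.

Lemma relationsB t v w : M t v -> M t w -> M t (v - w).
Proof.
move=> Hv Hw; apply: relationsD => //; rewrite -scaleN1r -[t]add0r.
by apply: relationsZ Hw; rewrite /= -mpolyC1 -mpolyCN /= -[_%:MP]mulr1 mul_mpolyC -mpolyX0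
  dhomogZ // dhomogX /= mdeg0.
Qed.

Lemma in_degreeXn (e : nat) (g : {mpoly K[3]}) N :
  g \is e.-homog -> in_degree (N * e)%N%:Z (g ^+ N).
Proof. by move=> Hg; rewrite /= mulnC dhomogMn. Qed.

Lemma relationsXn (e N N' : nat) (g : {mpoly K[3]}) v : g \is e.-homog ->
  M (N * e)%N%:Z v -> M ((N' + N) * e)%N%:Z (g ^+ N' *: v).
Proof.
by move=> Hg Hv; rewrite mulnDl PoszD; apply: relationsZ Hv; apply: in_degreeXn.
Qed.

Lemma frac_mem_add e g x y : g \is e.-homog ->
  frac_mem M e x -> frac_mem M e y -> frac_mem M e (frac_add g x y).
Proof.
move=> Hg Hx Hy; rewrite /frac_mem /=; apply: relationsD; last exact: relationsXn.
by rewrite addnC; apply: relationsXn.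
Qed.

Lemma frac_mem_scale e r k x : r \is (k * e)%N.-homog ->
  frac_mem M e x -> frac_mem M e (frac_scale (r, k) x).
Proof.
by move=> Hr Hx; rewrite /frac_mem /= mulnDl PoszD; apply: relationsZ.
Qed.

Lemma frac_mem_res e e' h x : h \is e'.-homog ->
  frac_mem M e x -> frac_mem M (e + e') (frac_res h x).
Proof.
move=> Hh Hx; rewrite /frac_mem /= mulnDr addnC PoszD.
by apply: relationsZ Hx; apply: in_degreeXn.
Qed.

Variable u : 'I_3 -> K.
Hypothesis uz : u var_z != 0.
Local Notation l := (linear_form u).
Local Notation q := (dehom u).

Lemma linear_form_neq0 : l != 0.
Proof.
apply: contraNneq uz => /(congr1 (mcoeff U_(var_z)%MM)).
by rewrite mcoeff0 /linear_form raddf_sum big_ord3 /= !mcoeffZ !mcoeffXU /=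
  !mulr0 !add0r mulr1 => ->.
Qed.

(** The difference of two fractions on the line, cleared of denominators. The factor [q g] makes it
    zero when D+(g) misses the line. *)
Definition cross (g : {mpoly K[3]}) m (X Y : 'rV[{poly K}]_m) (x2 y2 : nat) :=
  q g *: (q g ^+ y2 *: X - q g ^+ x2 *: Y).

(** Since [l] is a nonzerodivisor, dividing a relation by [l] gives a relation. Hence M/lM embeds
    into tuples over K[X]. *)
Lemma relations_sat t v : M t v -> map_mx q v = 0 ->
  exists w, M (t - 1) w /\ v = l *: w.
Proof.
move=> [Hv Ev] qv; have [i|h Hh] := @fin_all_exists _ _
    (fun i h => in_degree (t + p i - 1) h /\ v 0 i = l * h).
  by apply: (dehom_eq0 uz) => //; move/rowP/(_ i): qv; rewrite !mxE.
have Ew : v = l *: \row_i h i by apply/rowP => i; rewrite !mxE; case: (Hh i).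
exists (\row_i h i); split=> //; split=> [i|]; first by rewrite mxE addrAC; case: (Hh i).
apply/eqP; rewrite -(orFb (_ == 0)) -(negbTE linear_form_neq0) -mulf_eq0.
rewrite mulr_sumr -[X in _ == X]Ev Ew.
by apply/eqP/eq_bigr => i _; rewrite [in RHS]mxE mulrA.
Qed.

Lemma frac_eq_cross e g x y : g \is e.-homog ->
  frac_mem M e x -> frac_mem M e y ->
  frac_eq M l e g x y <->
  cross g (map_mx q x.1) (map_mx q y.1) x.2 y.2 = 0.
Proof.
move=> Hg Hx Hy; rewrite /cross -!rmorphXn -!map_mxZ -map_mxB.
split=> [[k [w [_ /(congr1 (map_mx q))]]]|].
  rewrite [in RHS]map_mxZ /= dehom_linear_form // scale0r map_mxZ rmorphXn /=.
  have [->|g0] := eqVneq (q g) 0; first by rewrite scale0r.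
  by move/eqP; rewrite scalemx_eq0 expf_eq0 (negbTE g0) andbF => /eqP ->; rewrite scaler0.
rewrite -map_mxZ => H; have := relations_sat _ H.
case/(_ ((1 + x.2 + y.2) * e)%N%:Z) => [|w [Mw Ew]].
  rewrite -addnA -[g in g *: _]expr1; apply: relationsXn => //.
  apply: relationsB; last exact: relationsXn.
  by rewrite addnC; apply: relationsXn.
by exists 1%N, w; rewrite expr1.
Qed.

End Relations.

Lemma twisted_freeE (K : fieldType) n (p : 'I_n -> int) t v :
  @twisted_free K n p t v <-> relations p (fun=> 0) t v.
Proof.
split=> [H|[]//]; split=> //.
by rewrite big1 // => i _; rewrite mulr0.
Qed.

Lemma frac_eq_twisted_free (K : fieldType) n (p : 'I_n -> int) l e g x y :
  frac_eq (@twisted_free K n p) l e g x y <->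
  frac_eq (relations p (fun=> 0)) l e g x y.
Proof.
by split=> -[k [w [Mw Ew]]]; exists k, w; split=> //; apply/twisted_freeE.
Qed.

Section SheafIso.
Variables (K : fieldType) (u : 'I_3 -> K) (k : nat) (G : k.-tuple 'X_{1..3}).
Variables (m d : nat) (s : 'M[{poly K}]_(m, k)) (p : 'I_m -> int).
Hypothesis uz : u var_z != 0.
Local Notation l := (linear_form u).
Local Notation q := (dehom u).
Local Notation A i := (mdeg (tnth G i)).
Hypothesis p_d : forall j, p j = - d%:Z.
Hypothesis s_deg : forall j i, poly_degree (d%:Z - (A i)%:Z) (s j i).
Hypothesis s_syz : forall j, \sum_i s j i * q 'X_[tnth G i] = 0.
Hypothesis s_inj : forall w : 'rV_m, w *m s = 0 -> w = 0.
Hypothesis s_gen : forall t (v : 'rV[{poly K}]_k),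
  (forall i, poly_degree (t - (A i)%:Z) (v 0 i)) ->
  \sum_i v 0 i * q 'X_[tnth G i] = 0 ->
  exists w : 'rV_m, (forall j, poly_degree (t - d%:Z) (w 0 j)) /\ v = w *m s.
Variable N0 : nat.
Hypothesis artin : forall n, (N0 <= mdeg n)%N -> mon_in_ideal G n.

Local Notation M := (@syz K k G).
Local Notation M' := (@twisted_free K m p).
Local Notation psi w := (map_mx q w *m s).

Lemma syz_coords t v : M t v -> exists w, M' t w /\ map_mx q v = psi w.
Proof.
move=> [Hv Ev]; have [i||w [Hw Ew]] := @s_gen t (map_mx q v).
- by rewrite mxE; apply/(poly_degree_dehom uz)/Hv.
- under eq_bigr => i _ do rewrite mxE -rmorphM.
  by rewrite -rmorph_sum Ev rmorph0.
have [j|h Hh] := @fin_all_exists _ _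
    (fun j h => in_degree (t + p j) h /\ q h = w 0 j).
  by rewrite p_d; apply: (dehom_surj uz).
exists (\row_j h j); split=> [j|]; first by rewrite mxE; case: (Hh j).
by rewrite Ew; congr (_ *m _); apply/rowP => j; rewrite !mxE; case: (Hh j).
Qed.

(** The lift to forms is unique only modulo [l]; this does not affect the fraction on the line, so
    any choice will do. *)
Definition coords (e : nat) (g : {mpoly K[3]}) (x : 'rV[{mpoly K[3]}]_k * nat) :
    'rV[{mpoly K[3]}]_m * nat :=
  (epsilon (inhabits 0)
     (fun w => M' (x.2 * e)%N%:Z w /\ map_mx q x.1 = psi w), x.2).

Lemma coordsP e g x : frac_mem M e x ->
  frac_mem M' e (coords e g x) /\ psi (coords e g x).1 = map_mx q x.1.
Proof.
move=> /syz_coords H; rewrite /coords /frac_mem /=.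
by have [? E] := epsilon_spec (inhabits 0) _ H; split; last exact: esym.
Qed.

Lemma frac_eq_psi e g x y : g \is e.-homog ->
  frac_mem M' e x -> frac_mem M' e y ->
  frac_eq M' l e g x y <-> cross u g (psi x.1) (psi y.1) x.2 y.2 = 0.
Proof.
move=> Hg /twisted_freeE Hx /twisted_freeE Hy.
rewrite frac_eq_twisted_free (frac_eq_cross uz Hg Hx Hy) /cross.
rewrite !scalemxAl -mulmxBl scalemxAl.
by split=> [->|/s_inj //]; rewrite mul0mx.
Qed.

Lemma frac_eq_psi_same e g x y : g \is e.-homog ->
  frac_mem M' e x -> frac_mem M' e y -> x.2 = y.2 -> psi x.1 = psi y.1 ->
  frac_eq M' l e g x y.
Proof.
move=> Hg Hx Hy E2 E1; apply/frac_eq_psi => //.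
by rewrite /cross E1 E2 subrr scaler0.
Qed.

(** A lift [v] of a syzygy on the line satisfies sum v_i f_i = l h. As R/I is Artinian, a power of
    [g] moves [h] into I, and subtracting [l] times the cofactors gives a true syzygy with a larger
    denominator. *)
Lemma coords_surj e g y : (0 < e)%N -> g \is e.-homog -> frac_mem M' e y ->
  exists x, frac_mem M e x /\ frac_eq M' l e g (coords e g x) y.
Proof.
case: y => w N e0 Hg /= Hw; pose t := (N * e)%N%:Z.
have [i|v Hv] := @fin_all_exists _ _
    (fun i h => in_degree (t - (A i)%:Z) h /\ q h = psi w 0 i).
  apply: (dehom_surj uz); rewrite mxE; apply: poly_degree_sum => j _.
  rewrite mxE (_ : t - _ = (t + p j) + (d%:Z - (A i)%:Z)); last by rewrite p_d; lia.
  by apply: poly_degreeM (s_deg _ _); apply: (poly_degree_dehom uz); apply: Hw.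
have Hvf : in_degree t (\sum_i v i * 'X_[tnth G i]).
  apply: in_degree_sum => i _ _; rewrite -[t](subrK (A i)%:Z).
  by apply: in_degreeM; [case: (Hv i) | apply: in_degreeX].
have [|h [Hh Eh]] := dehom_eq0 uz Hvf.
  rewrite rmorph_sum; under eq_bigr => i _.
    rewrite rmorphM /= (proj2 (Hv i)) mxE mulr_suml.
    under eq_bigr => j _ do rewrite -mulrA.
    over.
  rewrite exchange_big big1 // => j _ /=; rewrite -mulr_sumr.
  by rewrite s_syz mulr0.
(* The extra 1 compensates for the degree t-1 of [h]. *)
pose k0 := N0.+1.
have Hgh : in_degree ((k0 * e)%N%:Z + (t - 1)) (g ^+ k0 * h).
  by apply: in_degreeM Hh; apply: in_degreeXn.
have : in_ideal G (g ^+ k0 * h).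
  apply/in_ideal_msuppP => n /(in_degreeP _ _ Hgh) dn; apply: artin.
  suff : (N0.+1 <= k0 * e)%N by rewrite -lez_nat; move: dn; rewrite /t; lia.
  by rewrite leq_pmulr.
case/(in_ideal_homog Hgh) => P [HP EP].
pose x := (\row_i (g ^+ k0 * v i - l * P i), (k0 + N)%N).
have Hx : frac_mem M e x.
  rewrite /frac_mem /= mulnDl PoszD; split=> [i|].
    rewrite mxE; apply: in_degreeB.
      rewrite -addrA; apply: in_degreeM; last by case: (Hv i).
      exact: in_degreeXn.
    rewrite (_ : _ - _ = 1 + ((k0 * e)%N%:Z + (t - 1) - (A i)%:Z)); last first.
      by rewrite /t; lia.
    by apply: in_degreeM (HP i); apply: in_degree_linear_form.
  under eq_bigr => i _ do rewrite mxE mulrBl -!mulrA.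
  by rewrite sumrB -!mulr_sumr -EP Eh mulrCA subrr.
exists x; split=> //; have [Hc Ec] := coordsP g Hx.
apply/frac_eq_psi => //; rewrite Ec /cross /=.
have -> : map_mx q (\row_i (g ^+ k0 * v i - l * P i)) = q g ^+ k0 *: psi w.
  apply/rowP => i; rewrite [in LHS]mxE [in X in q X]mxE rmorphB !rmorphM rmorphXn /=.
  by rewrite dehom_linear_form // mul0r subr0 (proj2 (Hv i)) [in RHS]mxE.
by rewrite scalerA -exprD addnC subrr scaler0.
Qed.

Lemma syz_restrictions_iso : restrictions_iso M M' l.
Proof.
(* In the last three compatibilities both sides have the same denominator and the same restricted
   syzygy, so [frac_eq_psi_same] applies. *)
exists coords; split.
- by move=> e g _ _ x /(coordsP g) [].
- move=> e g _ Hg x y Hx Hy.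
  have [Hcx Ex] := coordsP g Hx; have [Hcy Ey] := coordsP g Hy.
  by rewrite (frac_eq_psi Hg Hcx Hcy) Ex Ey; apply: frac_eq_cross.
- by move=> e g e0 Hg y; apply: coords_surj.
- move=> e g e0 Hg x y Hx Hy.
  have [Hcx Ex] := coordsP g Hx; have [Hcy Ey] := coordsP g Hy.
  have [Hc Ec] := coordsP g (frac_mem_add Hg Hx Hy).
  apply: frac_eq_psi_same => //.
    by apply/twisted_freeE/frac_mem_add => //; apply/twisted_freeE.
  rewrite Ec /= !map_mxD !map_mxZ mulmxDl -!scalemxAl.
  by rewrite -/(coords e g x) -/(coords e g y) Ex Ey.
- move=> e g e0 Hg r N x Hr Hx.
  have [Hcx Ex] := coordsP g Hx.
  have [Hc Ec] := coordsP g (frac_mem_scale Hr Hx).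
  apply: frac_eq_psi_same => //.
    by apply/twisted_freeE/frac_mem_scale => //; apply/twisted_freeE.
  by rewrite Ec /= !map_mxZ -scalemxAl Ex.
move=> e g e' h e0 Hg e'0 Hh x Hx.
have [Hcx Ex] := coordsP g Hx.
have [Hc Ec] := coordsP (g * h) (frac_mem_res Hh Hx).
apply: frac_eq_psi_same => //; first exact: dhomogM.
  by apply/twisted_freeE/frac_mem_res => //; apply/twisted_freeE.
by rewrite Ec /= !map_mxZ -scalemxAl Ex.
Qed.

End SheafIso.

(** * Syzygies on a line *)

Section LineSyzygies.
Variables (K : fieldType) (u : 'I_3 -> K) (k : nat) (G : k.+1.-tuple 'X_{1..3}).
Variable d : nat.
Hypothesis d2 : (2 <= d)%N.
Hypothesis uz : u var_z != 0.
Local Notation l := (linear_form u).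
Local Notation q := (dehom u).
Local Notation A := (fun i => mdeg (tnth G i)).
Local Notation F := (fun i => q 'X_[tnth G i]).

Definition line_syz_eq0 :=
  forall p, poly_syz A F (d%:Z - 1) p -> p = 0.

Lemma in_degree_gens t (v : 'I_k.+1 -> {mpoly K[3]}) :
  (forall i, in_degree (t - (mdeg (tnth G i))%:Z) (v i)) ->
  in_degree t (\sum_i v i * 'X_[tnth G i]).
Proof.
move=> Hv; apply: in_degree_sum => i _ _; rewrite -[t](subrK (A i)%:Z).
by apply: in_degreeM => //; apply: in_degreeX.
Qed.

Lemma syz_line_lift t p : poly_syz A F t p ->
  exists (v : 'I_k.+1 -> {mpoly K[3]}) (h : {mpoly K[3]}),
    [/\ forall i, in_degree (t - (mdeg (tnth G i))%:Z) (v i),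
        forall i, q (v i) = p 0 i, in_degree (t - 1) h &
        \sum_i v i * 'X_[tnth G i] = l * h].
Proof.
move=> [Hp Ep]; have [i|v Hv] := @fin_all_exists _ _
    (fun i h => in_degree (t - (A i)%:Z) h /\ q h = p 0 i).
  exact: (dehom_surj uz).
have Hvf : in_degree t (\sum_i v i * 'X_[tnth G i]).
  by apply: in_degree_gens => i; case: (Hv i).
have [|h [Hh Eh]] := dehom_eq0 uz Hvf.
  rewrite rmorph_sum -[RHS]Ep; apply: eq_bigr => i _.
  by rewrite rmorphM /= (proj2 (Hv i)).
by exists v, h; split=> // i; case: (Hv i).
Qed.

(** Lift the syzygy to [v] with sum v_i f_i = l h. Injectivity puts [h] into I, which corrects [v]
    by a multiple of [l] to a syzygy over R of degree d-1; the lcm condition leaves only 0. *)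
Lemma inj_at_line_syz_eq0 :
  (forall i j m, i != j -> (tnth G i <= m)%MM -> (tnth G j <= m)%MM ->
    (d <= mdeg m)%N) ->
  inj_at G l (d - 2)%N%:Z -> line_syz_eq0.
Proof.
move=> lcm inj p /syz_line_lift [v [h [Hv qv Hh Eh]]].
have Ed : d%:Z - 1 - 1 = (d - 2)%N%:Z by lia.
rewrite Ed in Hh; have Ih : in_ideal G h by apply: inj => //; rewrite -Eh; exists v.
have [P [HP EP]] := in_ideal_homog Hh Ih.
pose w i := v i - l * P i.
have Hw i : in_degree (d%:Z - 1 - (mdeg (tnth G i))%:Z) (w i).
  apply: in_degreeB => //; rewrite (_ : _ - _ = 1 + ((d - 2)%N%:Z - (A i)%:Z)).
    by apply: in_degreeM (HP i); apply: in_degree_linear_form.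
  by lia.
have Ew : \sum_i w i * 'X_[tnth G i] = 0.
  under eq_bigr => i _ do rewrite mulrBl -mulrA.
  by rewrite sumrB -mulr_sumr -EP Eh subrr.
suff w0 i : w i = 0.
  apply/rowP => i; rewrite mxE -qv; move/eqP: (w0 i); rewrite subr_eq0 => /eqP ->.
  by rewrite rmorphM /= dehom_linear_form // mul0r.
apply/msuppnil0; case Es : (msupp (w i)) => [//|m r].
have mw : m \in msupp (w i) by rewrite Es mem_head.
have dm := in_degreeP _ _ (Hw i) _ mw.
(* This monomial has degree d-1, too small to be a common multiple of two generators, so no other
   summand can cancel it. *)
have := congr1 (mcoeff (tnth G i + m)%MM) Ew.
rewrite mcoeff0 raddf_sum (bigD1 i) //= mcoeffMX big1 => [|j ji].
  by rewrite addr0 => /eqP; rewrite mcoeff_eq0 mw.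
apply/eqP; rewrite mcoeff_eq0; apply/negP; rewrite (perm_mem (msuppMX _ _)).
case/mapP => n _ En; have := lcm _ _ (tnth G i + m)%MM ji.
by rewrite {1}En !lem_addr mdegD => /(_ isT isT); lia.
Qed.

(** If l h = sum P_i f_i, the restricted [P] is a syzygy on the line, hence 0. So [l] divides every
    P_i and can be cancelled. *)
Lemma line_syz_eq0_inj_at : line_syz_eq0 -> inj_at G l (d - 2)%N%:Z.
Proof.
move=> syz0 h Hh lh; have := in_degree_linear_formM u Hh.
rewrite succ_down // => Hlh; have [P [HP EP]] := in_ideal_homog Hlh lh.
have Ed : (d - 1)%N%:Z = d%:Z - 1 by lia.
rewrite Ed in HP; have P0 : \row_i q (P i) = 0.
  apply: syz0; split=> [i|]; first by rewrite mxE; apply: (poly_degree_dehom uz).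
  under eq_bigr => i _ do rewrite mxE -rmorphM.
  by rewrite -rmorph_sum -EP rmorphM /= dehom_linear_form // mul0r.
have [i|P' HP'] := @fin_all_exists _ _ (fun i h => P i = l * h).
  by have [|h' [_ ->]] := dehom_eq0 uz (HP i);
    [move/rowP/(_ i): P0; rewrite !mxE | exists h'].
exists P'; apply: (mulfI (linear_form_neq0 uz)); rewrite EP mulr_sumr.
by apply: eq_bigr => i _; rewrite HP' mulrA.
Qed.

Lemma surj_at_line_span : surj_at G l (d - 2)%N%:Z ->
  forall g, poly_degree (d%:Z - 1) g ->
  exists p, poly_tuple A (d%:Z - 1) p /\ g = \sum_i p 0 i * F i.
Proof.
have Ed : (d - 2)%N%:Z + 1 = d%:Z - 1 by lia.
move=> surj g /(dehom_surj uz) [f [Hf <-]].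
rewrite -Ed in Hf; have [h [Hh Ih]] := surj f Hf.
have Hfh := in_degreeB Hf (in_degree_linear_formM u Hh).
have [P [HP EP]] := in_ideal_homog Hfh Ih; rewrite Ed in HP.
exists (\row_i q (P i)); split=> [i|].
  by rewrite mxE; apply: (poly_degree_dehom uz).
have := congr1 q EP; rewrite rmorphB rmorphM /= dehom_linear_form // mul0r subr0.
by move=> ->; rewrite rmorph_sum; apply: eq_bigr => i _; rewrite rmorphM /= mxE.
Qed.

(** Chains four equalities of fractions with cleared denominators: a/xa = xd b/xb, b/xb = w/xn, e/xe
    = w' and a/xa = e/xe. *)
Lemma cancel_denominators (R : idomainType) (xa xb xe xn xn' xd a b w e w' : R) :
  xa != 0 -> xb != 0 -> xe != 0 -> xn' != 0 -> xd != 0 ->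
  xd * xb * a = xa * (xd * xd * b) -> xn * b = xb * w ->
  xn' * e = xe * (xn' * w') -> xe * a = xa * e -> xd * w = xn * w'.
Proof.
move=> xa0 xb0 xe0 xn0 xd0 E1 E2 E3 E4.
have {}E3 : e = xe * w' by apply: (mulfI xn0); rewrite E3 mulrCA.
have Ea : a = xa * w' by apply: (mulfI xe0); rewrite E4 E3 mulrCA.
apply: (mulfI (mulf_neq0 xa0 (mulf_neq0 xb0 xd0))).
transitivity (xa * (xd * xd) * (xb * w)); first by ring.
rewrite -E2 (_ : _ * _ * _ = xn * (xa * (xd * xd * b))); last by ring.
by rewrite -E1 Ea; ring.
Qed.

(** A syzygy [r] of degree d-1 gives sections r/x^(d-1) and r/y^(d-1) over D+(x) and D+(y) that
    differ by the transition factor (x/y)^(d-1). Their images glue to a section of a sum of copies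
    of O(-1), hence vanish. *)
Lemma iso_line_syz_eq0 (m : nat) (p : 'I_m -> int) (a0 : nat) :
  (forall j, p j = - d%:Z) ->
  mon_in_ideal G (U_(var_x) *+ a0)%MM -> mon_in_ideal G (U_(var_y) *+ a0)%MM ->
  restrictions_iso (@syz K k.+1 G) (@twisted_free K m p) l -> line_syz_eq0.
Proof.
move=> p_d Ix Iy [phi Hphi] r /syz_line_lift [v [h [Hv qv Hh Eh]]].
pose N := (a0 + (d - 1))%N.
(* Multiplying by a power of the variable that lies in I turns the lift of [r] into a true syzygy;
   [N] is the resulting degree of the numerator. *)
have sec i : mon_in_ideal G (U_(i) *+ a0)%MM -> exists x : 'rV[{mpoly K[3]}]_k.+1,
    frac_mem (@syz K k.+1 G) 1 (x, N) /\ map_mx q x = dehom_var u i ^+ a0 *: r.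
  move=> Ii; have Ih : in_ideal G (h * 'X_[U_(i) *+ a0]).
    by apply: in_idealMl; apply/in_idealX.
  have [P [HP EP]] := in_ideal_homog (in_degreeM Hh (in_degreeX _ _)) Ih.
  rewrite mdegMn mdeg1 mul1n in HP.
  exists (\row_i' ('X_[U_(i) *+ a0] * v i' - l * P i')); split.
    rewrite /frac_mem /= muln1; split=> [i'|].
      rewrite mxE; apply: in_degreeB.
        rewrite (_ : _ + _ = (mdeg (U_(i) *+ a0)%MM)%:Z +
                             (d%:Z - 1 - (A i')%:Z)).
          by apply: in_degreeM => //; apply: in_degreeX.
        by rewrite mdegMn mdeg1 /N; lia.
      rewrite (_ : _ + _ = 1 + (d%:Z - 1 - 1 + a0%:Z - (A i')%:Z)).
        by apply: in_degreeM (HP i'); apply: in_degree_linear_form.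
      by rewrite /N; lia.
    under eq_bigr => i' _ do rewrite mxE mulrBl -!mulrA.
    by rewrite sumrB -!mulr_sumr -EP Eh; ring.
  apply/rowP => i'; rewrite !mxE rmorphB !rmorphM /= dehom_linear_form // mul0r.
  by rewrite subr0 qv -mpolyXn rmorphXn /= dehom_X.
have [sx [Sx Ex]] := sec _ Ix; have [sy [Sy Ey]] := sec _ Iy.
case: (dehom_varE u) => Dx Dy _; rewrite Dx in Ex; rewrite Dy expr1n scale1r in Ey.
have X1 i : ('X_i : {mpoly K[3]}) \is 1.-homog by rewrite dhomogX /= mdeg1.
have X2 : ('X_var_x * 'X_var_y : {mpoly K[3]}) \is (1 + 1).-homog.
  exact: dhomogM.
have qX2 : q ('X_var_x * 'X_var_y) = 'X by rewrite rmorphM /= !dehom_X Dx Dy mulr1.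
have qX i : q ('X_i) = dehom_var u i by rewrite dehom_X.
have Xn0 n : ('X : {poly K}) ^+ n != 0 by rewrite expf_neq0 ?polyX_eq0.
have memM x e : frac_mem (@syz K k.+1 G) e x -> frac_mem (relations
  (fun i => - (A i)%:Z) (fun i => 'X_[tnth G i])) e x by [].
have memM' x e : frac_mem (@twisted_free K m p) e x <->
    frac_mem (relations p (fun=> 0)) e x by apply: twisted_freeE.
have eq_coords e g x y : g \is e.-homog -> q g = 'X ->
    frac_mem (@twisted_free K m p) e x -> frac_mem (@twisted_free K m p) e y ->
    frac_eq (@twisted_free K m p) l e g x y ->
    forall j, 'X ^+ y.2 * q (x.1 0 j) = 'X ^+ x.2 * q (y.1 0 j).
  move=> Hg qg /memM' Hx /memM' Hy /frac_eq_twisted_free.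
  rewrite (frac_eq_cross uz Hg Hx Hy) /cross qg => /eqP.
  rewrite scalemx_eq0 polyX_eq0 subr_eq0 => /eqP /rowP E j.
  by have := E j; rewrite !mxE.
(* The scalar is x^(2(d-1))/(xy)^(d-1), that is (x/y)^(d-1); it makes [rx] and [ry] equal over
   D+(xy). *)
pose rx := frac_scale ('X_var_x ^+ ((d - 1) + (d - 1)), (d - 1)%N)
  (frac_res 'X_var_y (sx, N)).
pose ry := frac_res 'X_var_x (sy, N).
have Hscale : ('X_var_x ^+ ((d - 1) + (d - 1)) : {mpoly K[3]})
    \is ((d - 1) * (1 + 1))%N.-homog.
  have := in_degreeXn ((d - 1) + (d - 1)) (X1 var_x).
  by rewrite /= (_ : ((d - 1 + (d - 1)) * 1 = (d - 1) * (1 + 1))%N) //; lia.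
have Rx : frac_mem (@syz K k.+1 G) (1 + 1) (frac_res 'X_var_y (sx, N)).
  exact: frac_mem_res.
have Srx : frac_mem (@syz K k.+1 G) (1 + 1) rx by apply: frac_mem_scale.
have Sry : frac_mem (@syz K k.+1 G) (1 + 1) ry by apply: frac_mem_res.
case: Hphi => Pmem Pinj _ _ Pscale Pres.
have Mx := Pmem 1%N _ isT (X1 var_x) _ Sx.
have My := Pmem 1%N _ isT (X1 var_y) _ Sy.
have MRx := Pmem (1 + 1)%N _ isT X2 _ Rx.
have Mrx := Pmem (1 + 1)%N _ isT X2 _ Srx.
have Mry := Pmem (1 + 1)%N _ isT X2 _ Sry.
have E1 := eq_coords _ _ _ _ X2 qX2 Mrx _ (Pscale (1 + 1)%N _ isT X2 _ _ _ Hscale Rx).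
have E2 := eq_coords _ _ _ _ X2 qX2 MRx _ (Pres 1%N _ 1%N _ isT (X1 _) isT (X1 _) _ Sx).
have R3 : frac_eq (@twisted_free K m p) l (1 + 1) ('X_var_x * 'X_var_y)
    (phi (1 + 1)%N ('X_var_x * 'X_var_y) ry)
    (frac_res 'X_var_x (phi 1%N 'X_var_y (sy, N))).
  by rewrite mulrC; apply: Pres.
have E3 := eq_coords _ _ _ _ X2 qX2 Mry _ R3.
have E4 := eq_coords _ _ _ _ X2 qX2 Mrx Mry.
move: E1 E2 E3 E4.
set pa := phi _ _ rx; set pb := phi _ _ (frac_res _ _); set pe := phi _ _ ry.
set pw := phi _ _ (sx, N); set pw' := phi _ _ (sy, N) => E1 E2 E3 E4.
have W0 j : q (pw.1 0 j) = 0.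
  have Hpw : poly_degree (pw.2%:Z - d%:Z) (q (pw.1 0 j)).
    apply: (poly_degree_dehom uz); have := Mx j.
    by rewrite p_d muln1.
  have H : 'X ^+ (d - 1) * q (pw.1 0 j) = 'X ^+ pw.2 * q (pw'.1 0 j).
    apply: (@cancel_denominators _ ('X ^+ pa.2) ('X ^+ pb.2) ('X ^+ pe.2) _
      ('X ^+ pw'.2) _ (q (pa.1 0 j)) (q (pb.1 0 j)) _ (q (pe.1 0 j))) => //.
    - have := E1 _ j; rewrite /= mxE rmorphM rmorphXn /= qX Dx !exprD; apply.
      by apply/memM'/frac_mem_scale; [rewrite -exprD | apply/memM'].
    - have := E2 _ j; rewrite /= mxE rmorphM rmorphXn /= qX Dy expr1n mul1r; apply.
      by apply/memM'/frac_mem_res => //; apply/memM'.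
    - have := E3 _ j; rewrite /= mxE rmorphM rmorphXn /= qX Dx; apply.
      by apply/memM'/frac_mem_res => //; apply/memM'.
    apply: E4; apply/(Pinj (1 + 1)%N _ isT X2) => //.
    apply/(frac_eq_cross uz X2) => //; rewrite /cross qX2 /=.
    rewrite !map_mxZ !rmorphXn /= !qX Dx Dy expr1n scale1r Ex Ey !scalerA -!exprD.
    by rewrite (_ : (_ + _ = d - 1 + N + N)%N) ?subrr ?scaler0 // /N; lia.
  (* In [H] the left side has degree below [pw.2], since [q (pw.1 0 j)] has degree at most pw.2 - d,
     whereas the right side is divisible by X to the power [pw.2]. *)
  have W'0 : q (pw'.1 0 j) = 0.
    apply/polyP => i; rewrite coef0.
    have := congr1 (fun f : {poly K} => f`_(pw.2 + i)) H.
    rewrite !coefXnM [(_ < pw.2)%N]ltnNge leq_addr /= addKn => <-.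
    case: ltnP => // le_d; apply: (poly_degreeP _ _ Hpw).
    by move: d2 le_d; clear; move: (pw.2) => n d2 le_d; lia.
  by move/eqP: H; rewrite W'0 mulr0 mulf_eq0 (negbTE (Xn0 _)) => /eqP.
(* Compatibility with the scalar 0 shows that [phi] maps the zero fraction to zero; injectivity then
   gives X^a0 r = 0. *)
pose z := frac_scale ((0 : {mpoly K[3]}), 0%N) (sx, N).
have h0 : (0 : {mpoly K[3]}) \is (0 * 1)%N.-homog by apply: dhomog0.
have Sz : frac_mem (@syz K k.+1 G) 1 z by apply: frac_mem_scale.
have Mz := Pmem 1%N _ isT (X1 var_x) _ Sz.
have Hz : frac_mem (@twisted_free K m p) 1
    (frac_scale ((0 : {mpoly K[3]}), 0%N) (phi 1%N 'X_var_x (sx, N))).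
  by apply/memM'/frac_mem_scale; last apply/memM'.
have qX1 : q 'X_var_x = 'X by rewrite qX.
have E5 := eq_coords _ _ _ _ (X1 var_x) qX1 Mz Hz
  (Pscale 1%N _ isT (X1 _) _ _ _ h0 Sx).
have Z0 j : q ((phi 1%N 'X_var_x z).1 0 j) = 0.
  have /eqP := E5 j; rewrite /= scale0r mxE rmorph0 mulr0 mulf_eq0.
  by rewrite (negbTE (Xn0 _)) => /eqP.
have : frac_eq (@syz K k.+1 G) l 1 'X_var_x (sx, N) z.
  apply: (proj2 (Pinj 1%N 'X_var_x isT (X1 var_x) _ _ Sx Sz)).
  apply/frac_eq_twisted_free.
  move/memM': Mx => Mx; move/memM': Mz => Mz.
  apply/(frac_eq_cross uz (X1 _) Mx Mz); rewrite /cross.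
  rewrite (_ : map_mx q pw.1 = 0); last by apply/rowP => j; rewrite !mxE W0.
  rewrite (_ : map_mx q (phi _ _ z).1 = 0); last by apply/rowP => j; rewrite !mxE Z0.
  by rewrite !scaler0 subrr scaler0.
move/(frac_eq_cross uz (X1 _) (memM _ _ Sx) (memM _ _ Sz)).
rewrite /cross /= scale0r map_mx0 scaler0 subr0 qX Dx Ex !scalerA => /eqP.
by rewrite scalemx_eq0 !mulf_eq0 polyX_eq0 !(negbTE (Xn0 _)) => /eqP.
Qed.

End LineSyzygies.

(** * General lines *)

Lemma infinite_field_nonroot (K : fieldType) (p : {poly K}) :
  infinite_field K -> p != 0 -> exists t, ~~ root p t.
Proof.
move=> Kinf p0.
have [s [us ss]] : exists s : seq K, uniq s /\ size s = size p.
  elim: (size p) => [|n [s [us <-]]]; first by exists [::].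
  by have [x xs] := Kinf s; exists (x :: s); rewrite /= xs us.
have : ~~ all (root p) s.
  by apply/negP => rs; have := max_poly_roots p0 rs us; rewrite ss ltnn.
by case/allPn => t _ Ht; exists t.
Qed.

Lemma digits_inj M a b a' b' : (a < M)%N -> (a' < M)%N ->
  (a + M * b = a' + M * b')%N -> a = a' /\ b = b'.
Proof.
move=> aM aM' E; have M0 : (0 < M)%N by apply: leq_ltn_trans aM.
have Ea : a = a'.
  have := congr1 (modn^~ M) E.
  by rewrite /= ![(M * _)%N]mulnC ![(_ + _ * M)%N]addnC !modnMDl !modn_small.
by split=> //; move: E; rewrite Ea => /addnI /eqP; rewrite eqn_pmul2l // => /eqP.
Qed.

(* Kronecker substitution: restrict P to the curve (t, t^M, t^(M^2)). *)
Lemma infinite_field_meval (K : fieldType) (P : {mpoly K[3]}) :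
  infinite_field K -> P != 0 -> exists u, P.@[u] != 0.
Proof.
move=> Kinf P0; pose M := msize P.
pose e (m : 'X_{1..3}) := (m var_x + M * (m var_y + M * m var_z))%N.
have lt_M m i : m \in msupp P -> (m i < M)%N.
  move/msize_mdeg_lt; apply: leq_ltn_trans.
  by rewrite mdegE (bigD1 i) //= leq_addr.
have e_inj m n : m \in msupp P -> n \in msupp P -> e m = e n -> m = n.
  move=> Pm Pn /digits_inj [||Ex]; rewrite ?lt_M // => /digits_inj [||Ey Ez];
    rewrite ?lt_M //.
  by rewrite [m]mon3_eta [n]mon3_eta Ex Ey Ez.
pose Q : {poly K} := \sum_(m <- msupp P) P@_m *: 'X^(e m).
have Q0 : Q != 0.
  case Es : (msupp P) => [|m s]; first by rewrite (msuppnil0 Es) eqxx in P0.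
  have Pm : m \in msupp P by rewrite Es mem_head.
  apply/eqP => /(congr1 (fun q : {poly K} => q`_(e m))).
  rewrite coef0 coef_sum (bigD1_seq m) ?msupp_uniq //= coefZ coefXn eqxx mulr1.
  rewrite big_seq_cond big1 => [|n /andP [Pn nm]].
    by rewrite addr0 => /eqP; rewrite mcoeff_eq0 Pm.
  rewrite coefZ coefXn; case: eqP => [/e_inj E|]; last by rewrite mulr0.
  by rewrite E ?eqxx in nm.
have [t Ht] := infinite_field_nonroot Kinf Q0.
exists (fun i => t ^+ (M ^ i)); apply: contraNneq Ht => HP; rewrite rootE -{}HP.
rewrite /Q horner_sum mevalE; apply/eqP/eq_bigr => m _.
rewrite hornerZ hornerXn big_ord3 /= -!exprM -!exprD; congr (_ * _ ^+ _).
by rewrite /e expn0 expn1 mul1n -mulnn mulnDr mulnA.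
Qed.

Lemma homog1_linear_form (K : fieldType) (l : {mpoly K[3]}) :
  l \is 1.-homog -> l = linear_form (fun i => l@_(U_(i)%MM)).
Proof.
move=> /dhomogP Hl; rewrite /linear_form; apply/mpolyP => m; rewrite raddf_sum /=.
have [/mdeg1P [i /eqP ->]|Hm] := boolP (mdeg m == 1%N).
  rewrite (bigD1 i) //= mcoeffZ mcoeffXU eqxx mulr1 big1 ?addr0 // => j ji.
  by rewrite mcoeffZ mcoeffXU (negbTE ji) mulr0.
rewrite big1 => [|i _].
  by apply/eqP; rewrite mcoeff_eq0; apply: contra Hm => /Hl /eqP.
rewrite mcoeffZ mcoeffX; case: eqP => [E|]; last by rewrite mulr0.
by rewrite -E mdeg1 in Hm.
Qed.

Theorem theorem10p23 (K : fieldType) (a b c al be ga d : nat)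
    (Kinf : infinite_field K)
    (hal : (0 < al < a)%N) (hbe : (0 < be < b)%N) (hga : (0 < ga < c)%N)
    (hd : (3 * d = a + b + c + al + be + ga)%N)
    (hmax : (maxn a (maxn b (maxn c (al + be + ga))) <= d)%N)
    (hmin1 : (d <= minn (al + be + c) (minn (al + b + ga) (a + be + ga)))%N)
    (hmin2 : (d <= minn (a + b) (minn (a + c) (b + c)))%N) :
  let G := gens4 a b c al be ga in
  exists (eN : size (lattice_ends d G) = size (lattice_starts d G))
         (eZ : size (up_triangles d G) = size (down_triangles d G)),
  [<-> weak_lefschetz (@in_ideal K 4 G);
       (\det (castmx (erefl, eN) (Nmat d G)))%:~R != 0 :> K;
       (\det (castmx (erefl, eZ) (Zmat d G)))%:~R != 0 :> K;
       generic_splitting_type (@syz K 4 G) (- d%:Z) (- d%:Z) (- d%:Z)].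
Proof.
move=> G; case/andP: hal => al0 ala; case/andP: hbe => be0 beb.
case/andP: hga => ga0 gac; move: hmax hmin1 hmin2.
rewrite !geq_max !leq_min => /and4P [ad bd cd abcd] /and3P [dc db da].
case/and3P => dab dac dbc.
have d2 : (2 <= d)%N by lia.
have eN : size (lattice_ends d G) = size (lattice_starts d G).
  by rewrite size_starts // size_ends.
have eZ := size_up_down d2 eN; exists eN, eZ.
(* The lower bounds by d are exactly the degrees of the pairwise lcms of the generators, for
   instance a + b and a + be + ga. *)
have lcm (i j : 'I_4) m : i != j -> (tnth G i <= m)%MM -> (tnth G j <= m)%MM ->
    (d <= mdeg m)%N.
  rewrite !(tnth_nth 0%MM) !lem3E mdeg3.
  case: i j => [[|[|[|[|//]]]] Hi] [[|[|[|[|//]]]] Hj] //= _;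
    rewrite /mon3 /fun_of_multinom /tnth /=; lia.
have Atop (i : 'I_4) : (mdeg (tnth G i) <= d)%N.
  rewrite (tnth_nth 0%MM) mdeg3.
  case: i => [[|[|[|[|//]]]] Hi]; rewrite /= /mon3 /fun_of_multinom /tnth /=; lia.
have socle := @gens4_socle a b c al be ga d.
have inj_wl (u : 'I_3 -> K) : inj_at G (linear_form u) (d - 2)%N%:Z ->
    weak_lefschetz (@in_ideal K 4 G).
  move=> inj; apply: (@weak_lefschetz_suff _ _ _ d _ (linear_form u)) => //.
  - by move=> m; apply: socle.
  - exact: (in_degree_linear_form u).
  by apply/(det_surj d2 eZ)/(det_inj d2 eZ).
tfae.
- case=> l [/homog1_linear_form -> H]; apply/(det_N_Z K d2 eN eZ).
  rewrite det_Zmat.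
  have : \det (weight_mx G d (fun i => l@_(U_(i)%MM))) != 0.
    case: (H (d - 2)%N%:Z) => [inj|surj]; first exact/(det_inj d2 eZ).
    exact/(det_surj d2 eZ).
  by rewrite det_weight_mx // mulf_eq0 negb_or => /andP [].
- by move/(det_N_Z K d2 eN eZ).
(* Off the curve xyz = 0 all coefficients of the line are nonzero, so the weights do not affect the
   vanishing of the determinant. *)
- rewrite det_Zmat => Z0; exists 3, 'X_[mon3 1 1 1]; split.
  + by rewrite dhomogX /= mdeg3.
  + by rewrite -msupp_eq0 msuppX.
  move=> u _; rewrite mevalX => /prodf_neq0 u0.
  have {}u0 i : u i != 0.
    by have := u0 i isT; elim/ord3P: i => //; rewrite expf_neq0.
  have uz := u0 var_z; rewrite -/(linear_form u).
  have Wu : \det (weight_mx G d u) != 0.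
    rewrite det_weight_mx // mulf_neq0 //; apply/prodf_neq0 => i _.
    exact: expf_neq0.
  have /(inj_at_line_syz_eq0 d2 uz lcm) syz0 := elimT (det_inj d2 eZ u) Wu.
  have span := surj_at_line_span d2 uz (elimT (det_surj d2 eZ u) Wu).
  (* The generator y^b dehomogenizes to 1. *)
  pose j0 : 'I_4 := @Ordinal 4 1 isT.
  have [||s [s_syz s_inj s_gen]] := @poly_syz_basis K 3 _ _ d j0 _ _ Atop syz0 span.
  + by move=> i; apply/(poly_degree_dehom uz)/in_degreeX.
  + rewrite (tnth_nth 0%MM) /= /dehom mmapX /mmap1 big_ord3 /=.
    case: (dehom_varE u) => _ -> _; rewrite !expr0 expr1n !mulr1.
    by rewrite coef1.
  apply: (@syz_restrictions_iso K u 4 G 3 d s _ uz _ _ _ s_inj _ (a + b + c)).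
  + by elim/ord3P.
  + by move=> j i; have [/(_ i)] := s_syz j; rewrite mxE.
  + move=> j; have [_ E] := s_syz j; rewrite -[RHS]E.
    by apply: eq_bigr => i _; rewrite mxE.
  + by move=> t v Hv Ev; apply: s_gen.
  by move=> m; rewrite mon_in_gens4 mdeg3; lia.
case=> k [P [_ P0 H]].
(* The extra factor z yields a line in the open set with [u var_z] nonzero, as dehomogenization
   requires. *)
have [|u] := @infinite_field_meval K (P * 'X_var_z) Kinf.
  by rewrite mulf_neq0 // -msupp_eq0 msuppX.
rewrite mevalM mevalXU mulf_eq0 negb_or => /andP [Pu uz].
have iso := H u (ex_intro (fun i => is_true (u i != 0)) var_z uz) Pu; rewrite -/(linear_form u) in iso.
apply/(inj_wl u)/(line_syz_eq0_inj_at d2 uz).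
apply: (iso_line_syz_eq0 (a0 := (a + b)%N) d2 uz _ _ _ iso).
- by elim/ord3P.
- by rewrite mon_in_gens4 !mulmnE !mnm1E /=; lia.
by rewrite mon_in_gens4 !mulmnE !mnm1E /=; lia.
Qed.
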